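(* Let $(B,g_B)$ and $(F,g_F)$ be two radical-stationary singular semi-Riemannian manifolds, and let $f\in C^\infty(B)$ be a smooth function such that $df\in\mathcal A^\bullet(B)$. Then the degenerate warped product $B\times_f F$ is a radical-stationary singular semi-Riemannian manifold.
   Context: A singular semi-Riemannian manifold $(M,g)$ is a smooth manifold $M$ with a smooth symmetric bilinear form $g=\langle\cdot,\cdot\rangle$ on $TM$ (called the metric), which may be degenerate and may have variable signature. $\mathfrak X(M)$ denotes the smooth vector fields on $M$. For $p\in M$, $(T_pM)^\bullet\subseteq T_p^*M$ is the space of covectors of the form $\langle Y_p,\cdot\rangle$ with $Y_p\in T_pM$. $\mathcal A^\bullet(M)$ is the set of smooth $1$-forms $\omega$ on $M$ with $\omega_p\in(T_pM)^\bullet$ for every $p\in M$. The Koszul form of $(M,g)$ is, for $X,Y,Z\in\mathfrak X(M)$, $$\mathcal K(X,Y,Z):=\tfrac12\{X\langle Y,Z\rangle+Y\langle Z,X\rangle-Z\langle X,Y\rangle-\langle X,[Y,Z]\rangle+\langle Y,[Z,X]\rangle+\langle Z,[X,Y]\rangle\}.$$ It is $C^\infty(M)$-linear in $Z$, so $\mathcal K(X,Y,\cdot)$ is a smooth $1$-form. $(M,g)$ is radical-stationary if $\mathcal K(X,Y,\cdot)\in\mathcal A^\bullet(M)$ for all $X,Y\in\mathfrak X(M)$. Degenerate warped product: given singular semi-Riemannian manifolds $(B,g_B)$, $(F,g_F)$ and $f\in C^\infty(B)$ (with zeros and negative values allowed), $B\times_f F$ is the manifold $B\times F$ with metric $\pi_B^*g_B+(f\circ\pi_B)^2\,\pi_F^*g_F$,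 where $\pi_B,\pi_F$ are the canonical projections. *)

(* Defs.v *)
(* [R : realType] stands for the field of real numbers. *)
From HB Require Import structures.
From mathcomp Require Import all_boot all_order all_algebra.
From mathcomp Require Import all_classical all_reals all_analysis.

Set Implicit Arguments.
Unset Strict Implicit.
Unset Printing Implicit Defensive.

Import Order.TTheory GRing.Theory Num.Theory numFieldNormedType.Exports.

Local Open Scope classical_set_scope.
Local Open Scope ring_scope.

Section Euclidean.
Variables (R : realType) (n : nat) (W : normedModType R).

(* For [U] open: [f] is C^(k+1) on [U] when it is Frechet differentiable on
   [U] and its derivative is C^k, i.e. all directional derivatives are. *)
Fixpoint Ck_on (k : nat) (U : set 'rV[R]_n) (f : 'rV[R]_n -> W) : Prop :=
  match k with
  | 0 => forall x, U x -> {for x, continuous f}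
  | k'.+1 => (forall x, U x -> differentiable f x) /\
             (forall v : 'rV[R]_n, Ck_on k' U (fun x => 'D_v f x))
  end.

Definition smooth_on (U : set 'rV[R]_n) (f : 'rV[R]_n -> W) : Prop :=
  forall k, Ck_on k U f.

End Euclidean.

(* [chart_map] and [chart_inv] are total; only their restrictions to
   [chart_dom] and [chart_img] are meaningful. *)
Record chart (R : realType) (M : topologicalType) (n : nat) := Chart {
  chart_dom : set M;
  chart_map : M -> 'rV[R]_n;
  chart_inv : 'rV[R]_n -> M }.

Section Manifold.
Variables (R : realType) (M : topologicalType) (n : nat).
Implicit Types (c d : chart R M n) (A : set (chart R M n)).

Definition chart_img c : set 'rV[R]_n := chart_map c @` chart_dom c.

Definition is_chart c : Prop :=
  [/\ open (chart_dom c), open (chart_img c),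
      {within chart_dom c, continuous (chart_map c)},
      {within chart_img c, continuous (chart_inv c)}
    & forall p, chart_dom c p -> chart_inv c (chart_map c p) = p].

Definition smooth_transition c d : Prop :=
  smooth_on (chart_map c @` (chart_dom c `&` chart_dom d))
            (chart_map d \o chart_inv c).

Definition smooth_manifold A : Prop :=
  [/\ hausdorff_space M, @second_countable M,
      forall c, A c -> is_chart c,
      forall p, exists2 c, A c & chart_dom c p
    & forall c d, A c -> A d -> smooth_transition c d].

Definition smooth_fun A (h : M -> R) : Prop :=
  forall c, A c -> smooth_on (chart_img c) (h \o chart_inv c).

(* Tangent vectors are represented by the operators they induce on smooth
   functions, with the value 0 at non-smooth arguments, so that equality of
   tangent vectors is equality of operators. *)
Definition tvector := (M -> R) -> R.

Definition coord_tvector A c (p : M) (u : 'rV[R]_n) : tvector :=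
  fun h => if `[< smooth_fun A h >]
           then 'D_u (h \o chart_inv c) (chart_map c p) else 0.

(* The vector space structure on it is the pointwise one. *)
Definition tangent A (p : M) : set tvector :=
  [set v | exists c, exists u, [/\ A c, chart_dom c p &
                                   v = coord_tvector A c p u]].

Definition vact (X : M -> tvector) (h : M -> R) : M -> R := fun p => X p h.

Definition vector_field A (X : M -> tvector) : Prop :=
  (forall p, tangent A p (X p)) /\
  (forall h, smooth_fun A h -> smooth_fun A (vact X h)).

(* At a non-smooth [h] this is 0, as it should be: [vact X h] and [vact Y h]
   are then 0. *)
Definition lie_bracket (X Y : M -> tvector) : M -> tvector :=
  fun p h => X p (vact Y h) - Y p (vact X h).

Definition linear_on_tangent A (p : M) (alpha : tvector -> R) : Prop :=
  forall (a : R) (u v : tvector), tangent A p u -> tangent A p v ->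
    alpha (a *: u + v) = a * alpha u + alpha v.

Definition one_form A (omega : M -> tvector -> R) : Prop :=
  (forall p, linear_on_tangent A p (omega p)) /\
  (forall Z, vector_field A Z -> smooth_fun A (fun p => omega p (Z p))).

Definition dform (f : M -> R) : M -> tvector -> R := fun p v => v f.

(* [g p] is only meaningful on the tangent space at [p]. *)
Definition metric := M -> tvector -> tvector -> R.

Definition smooth_metric A (g : metric) : Prop :=
  [/\ forall p u v, tangent A p u -> tangent A p v -> g p u v = g p v u,
      forall p u, tangent A p u -> linear_on_tangent A p (g p u)
    & forall X Y, vector_field A X -> vector_field A Y ->
        smooth_fun A (fun p => g p (X p) (Y p))].

Definition singular_semi_riemannian A (g : metric) : Prop :=
  smooth_manifold A /\ smooth_metric A g.

Definition bullet A (g : metric) (p : M) (alpha : tvector -> R) : Prop :=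
  exists2 y, tangent A p y & forall z, tangent A p z -> alpha z = g p y z.

Definition bullet_form A (g : metric) (omega : M -> tvector -> R) : Prop :=
  one_form A omega /\ forall p, bullet A g p (omega p).

Definition inner (g : metric) (X Y : M -> tvector) : M -> R :=
  fun p => g p (X p) (Y p).

Definition koszul (g : metric) (X Y Z : M -> tvector) : M -> R := fun p =>
  2^-1 * (vact X (inner g Y Z) p + vact Y (inner g Z X) p
          - vact Z (inner g X Y) p
          - inner g X (lie_bracket Y Z) p + inner g Y (lie_bracket Z X) p
          + inner g Z (lie_bracket X Y) p).

(* "K(X, Y, .) is in A^bullet(M)": the pointwise 1-form [omega] corresponding
   to the C^oo(M)-linear map Z |-> K(X, Y, Z) is such a form. *)
Definition radical_stationary A (g : metric) : Prop :=
  forall X Y, vector_field A X -> vector_field A Y ->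
    exists2 omega, bullet_form A g omega &
      forall Z, vector_field A Z -> forall p, omega p (Z p) = koszul g X Y Z p.

End Manifold.

Definition differential (R : realType) (M N : topologicalType) (n : nat)
    (A : set (chart R N n)) (phi : M -> N) (v : tvector R M) : tvector R N :=
  fun h => if `[< smooth_fun A h >] then v (h \o phi) else 0.

Definition pullback_metric (R : realType) (M N : topologicalType) (n : nat)
    (A : set (chart R N n)) (phi : M -> N) (g : metric R N) : metric R M :=
  fun p u v => g (phi p) (differential A phi u) (differential A phi v).

Section Product.
Variables (R : realType) (B F : topologicalType) (m n : nat).

Definition prod_chart (c : chart R B m) (d : chart R F n) :
    chart R (B * F)%type (m + n) :=
  {| chart_dom := chart_dom c `*` chart_dom d;
     chart_map := fun p => row_mx (chart_map c p.1) (chart_map d p.2);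
     chart_inv := fun x => (chart_inv c (lsubmx x), chart_inv d (rsubmx x)) |}.

Definition prod_atlas (AB : set (chart R B m)) (AF : set (chart R F n)) :
    set (chart R (B * F)%type (m + n)) :=
  [set prod_chart c d | c in AB & d in AF].

Definition warped_metric (AB : set (chart R B m)) (AF : set (chart R F n))
    (gB : metric R B) (gF : metric R F) (f : B -> R) : metric R (B * F)%type :=
  fun p u v => pullback_metric AB fst gB p u v
               + f p.1 ^+ 2 * pullback_metric AF snd gF p u v.

End Product.

(* Main.v *)
Require Import Defs.
From mathcomp Require Import all_boot all_order all_algebra.
From mathcomp Require Import all_classical all_reals all_analysis.
From mathcomp Require Import ring lra.

(* In a chart, write [G] for the metric and
   [Gamma(u, v, w) = (D_u G(v, w) + D_v G(w, u) - D_w G(u, v)) / 2].  The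
   product rule gives [K(X, Y, Z) = G(D_X Y, Z) + Gamma(X, Y, Z)], and the
   first term is always a bullet form in [Z]; hence the metric is
   radical-stationary iff every 1-form [Gamma(u, v, .)] with [u], [v] constant
   lies in the image of [G].  For the warped product, with [u = (u1, u2)] etc.,
     [Gamma(u, v, w) = Gamma_B(u1, v1, w1) + f^2 Gamma_F(u2, v2, w2)
        + f (df(u1) G_F(v2, w2) + df(v1) G_F(u2, w2) - df(w1) G_F(u2, v2))].
   If [a], [k], [b] represent [Gamma_B(u1, v1, .)], [Gamma_F(u2, v2, .)] and
   [df], then this form in [w] is represented by the vector with components
   [a - f G_F(u2, v2) b] and [k + f^-1 (df(u1) v2 + df(v1) u2)], also where
   [f] vanishes (there [f^-1 = 0]), since the terms in [w2] carry a factor [f].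

   Vector fields and smooth functions are global objects here, so reading them
   in a chart requires cut-off functions, built from [exp (-1/t)]. *)

Set Implicit Arguments.
Unset Strict Implicit.
Unset Printing Implicit Defensive.

Import Order.TTheory GRing.Theory Num.Theory numFieldNormedType.Exports.

Local Open Scope classical_set_scope.
Local Open Scope ring_scope.

(** * Smooth functions on open subsets of Euclidean space *)

(** Write [g] as [f + (g - f)]: the second summand vanishes near [x], so it is differentiable there
    with differential 0. *)
Lemma near_eq_differentiable (R : numFieldType) (V W : normedModType R)
    (f g : V -> W) (x : V) :
  (\near x, f x = g x) -> differentiable f x -> differentiable g x.
Proof.
move=> fg df; rewrite -(subrKC f g); apply: differentiableD => //.
have nz : \forall h \near (0 : V), (g - f) (h + x) = 0.
  move: fg; rewrite (near_shift (0 : V) x) subr0 => fg.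
  by apply: filterS fg => h /= e; rewrite !fctE e subrr.
have ez : (g - f) \o shift x = cst ((g - f) x) + (0 : V -> W) +o_ (0 : V) id.
  apply/eqaddoP => eps eps0; apply: filterS nz => h hz.
  rewrite !fctE /= -[_ (h + x) - _ (h + x)]/((g - f) (h + x)) hz.
  rewrite (nbhs_singleton fg) subrr addr0 subr0 normr0.
  by rewrite mulr_ge0// ltW.
have cz : continuous (\0 : V -> W) by exact: cst_continuous.
have dz : 'd (g - f) x = \0 :> (V -> W) by apply: diff_unique.
by apply/diff_locallyP; rewrite dz.
Qed.

Section Ck.
Variables (R : realType) (n : nat).
Implicit Types (U V : set 'rV[R]_n).

Lemma Ck_onW (W : normedModType R) k U (f : 'rV[R]_n -> W) :
  Ck_on k.+1 U f -> Ck_on k U f.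
Proof.
elim: k f => [|k IH] f [df Df] /=.
  by move=> x Ux; apply: differentiable_continuous; exact: df.
by split => // v; apply: IH; exact: Df.
Qed.

Lemma Ck_on_sub (W : normedModType R) k U V (f : 'rV[R]_n -> W) :
  V `<=` U -> Ck_on k U f -> Ck_on k V f.
Proof.
move=> VU; elim: k f => [|k IH] f /=.
  by move=> cf x /VU; exact: cf.
by move=> [df Df]; split => [x /VU|v]; [exact: df|exact/IH/Df].
Qed.

(** The set [V] may be arbitrary, since continuity and differentiability at a point of [V] are taken
    in the whole space and not within [V]. *)
Lemma Ck_on_local (W : normedModType R) k U (f : 'rV[R]_n -> W) :
  (forall x, U x -> exists V, V x /\ Ck_on k V f) -> Ck_on k U f.
Proof.
elim: k f => [|k IH] f /= H.
  by move=> x /H[V [Vx]]; exact.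
split=> [x /H[V [Vx []]]|v]; first by move=> + _; exact.
by apply: IH => x /H[V [Vx [_ Df]]]; exists V.
Qed.

Lemma Ck_on_cst (W : normedModType R) k U (a : W) : Ck_on k U (cst a).
Proof.
elim: k a => [|k IH] a /=; first by move=> x _; exact: cst_continuous.
split=> [x _|v]; first exact: differentiable_cst.
rewrite (_ : (fun x => _) = cst 0)//.
by apply/funext => x; rewrite derive_cst.
Qed.

Lemma near_open U x (P : 'rV[R]_n -> Prop) :
  open U -> U x -> (forall y, U y -> P y) -> \near x, P x.
Proof. by move=> oU Ux H; apply: filterS H _; exact: open_nbhs_nbhs. Qed.

(** Openness turns equality on [U] into equality near each point of [U], so the directional
    derivatives agree on [U] as well and the induction goes on. *)
Lemma Ck_on_eq (W : normedModType R) k U (f g : 'rV[R]_n -> W) :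
  open U -> (forall x, U x -> f x = g x) -> Ck_on k U f -> Ck_on k U g.
Proof.
move=> oU; elim: k f g => [|k IH] f g fg.
  move=> cf x Ux; rewrite /prop_for /continuous_at -fg//.
  apply: cvg_trans (cf x Ux).
  by apply: (@near_eq_cvg _ _ (nbhs x)); exact: (near_open oU Ux fg).
move=> [df Df]; split=> [x Ux|v].
  by apply: near_eq_differentiable (df x Ux); exact: (near_open oU Ux fg).
apply: IH (Df v) => x Ux; apply: near_eq_derive; exact: (near_open oU Ux fg).
Qed.

Lemma Ck_onD (W : normedModType R) k U (f g : 'rV[R]_n -> W) : open U ->
  Ck_on k U f -> Ck_on k U g -> Ck_on k U (fun x => f x + g x).
Proof.
move=> oU; elim: k f g => [|k IH] f g /=.
  by move=> cf cg x Ux; apply: continuousD; [exact: cf|exact: cg].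
move=> [df Df] [dg Dg]; split=> [x Ux|v].
  by apply: differentiableD; [exact: df|exact: dg].
apply: Ck_on_eq (IH _ _ (Df v) (Dg v)) => // x Ux.
by rewrite deriveD//; apply: diff_derivable; [exact: df|exact: dg].
Qed.

Lemma Ck_on_sum (W : normedModType R) k U m (f : 'I_m -> 'rV[R]_n -> W) :
  open U -> (forall i, Ck_on k U (f i)) -> Ck_on k U (fun x => \sum_i f i x).
Proof.
move=> oU H; rewrite -fct_sumE; elim/big_ind: _ => //; first exact: Ck_on_cst.
by move=> g h; exact: Ck_onD.
Qed.

(** The product rule mixes each function with the derivative of the other, so the induction also
    uses [f] and [g] one order lower, through [Ck_onW]. *)
Lemma Ck_onM k U (f g : 'rV[R]_n -> R) : open U ->
  Ck_on k U f -> Ck_on k U g -> Ck_on k U (fun x => f x * g x).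
Proof.
move=> oU; elim: k f g => [|k IH] f g.
  by move=> cf cg x Ux; apply: continuousM; [exact: cf|exact: cg].
move=> kf kg; have [df Df] := kf; have [dg Dg] := kg; split=> [x Ux|v].
  by apply: differentiableM; [exact: df|exact: dg].
have Fg := IH _ _ (Ck_onW kf) (Dg v).
have Gf := IH _ _ (Ck_onW kg) (Df v).
apply: Ck_on_eq (Ck_onD oU Fg Gf) => // x Ux.
by rewrite deriveM//; apply: diff_derivable; [exact: df|exact: dg].
Qed.

Lemma Ck_onZl (W : normedModType R) k U (f : 'rV[R]_n -> R) (w : W) : open U ->
  Ck_on k U f -> Ck_on k U (fun x => f x *: w).
Proof.
move=> oU; elim: k f => [|k IH] f.
  by move=> cf x Ux; apply: continuousZr_tmp; exact: cf.
move=> [df Df]; split=> [x Ux|v].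
  by apply: differentiableZl; exact: df.
apply: Ck_on_eq (IH _ (Df v)) => // x Ux.
have d := df x Ux; rewrite (deriveE _ d) deriveE ?diffZl//.
exact: differentiableZl.
Qed.

Lemma Ck_onV k U (f : 'rV[R]_n -> R) : open U -> (forall x, U x -> f x != 0) ->
  Ck_on k U f -> Ck_on k U (fun x => (f x)^-1).
Proof.
move=> oU f0; elim: k => [|k IH].
  by move=> cf x Ux; apply: continuousV; [exact: f0|exact: cf].
move=> kf; have [df Df] := kf; split=> [x Ux|v].
  by apply: differentiableV; [exact: df|exact: f0].
have I := IH (Ck_onW kf).
(* The derivative [- f^-2 * D_v f], in which [f^-1] is C^k by induction. *)
have N := Ck_onM oU (@Ck_on_cst R k U (-1)) (Ck_onM oU (Ck_onM oU I I) (Df v)).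
apply: Ck_on_eq N => // x Ux; rewrite deriveV ?f0//; last first.
  by apply: diff_derivable; exact: df.
by rewrite /cst mulN1r -expr2 exprVn scaleNr.
Qed.

Lemma derive_coord (x v : 'rV[R]_n) j :
  'D_v (fun y : 'rV[R]_n => y 0 j) x = v 0 j.
Proof.
have := @derive_mx R _ _ _ id x v (@derivable_id _ _ _ _).
by rewrite derive_id => /matrixP/(_ 0 j); rewrite mxE.
Qed.

Lemma Ck_on_coord k U j : Ck_on k U (fun x : 'rV[R]_n => x 0 j).
Proof.
case: k => [|k] /=; first by move=> x _; exact: coord_continuous.
split=> [x _|v]; first exact: differentiable_coord.
rewrite (_ : (fun x => _) = cst (v 0 j)); first exact: Ck_on_cst.
by apply/funext => x; exact: derive_coord.
Qed.

Lemma Ck_on_coordP k U m (f : 'rV[R]_n -> 'rV[R]_m) : open U ->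
  Ck_on k U f <-> forall j, Ck_on k U (fun x => f x 0 j).
Proof.
move=> oU; split.
  elim: k f => [|k IH] f /=.
    move=> cf j x Ux.
    exact: (continuous_comp (cf x Ux) (@coord_continuous _ _ _ _ _ _)).
  move=> [df Df] j; split=> [x Ux|v].
    exact: (differentiable_comp (df x Ux) (differentiable_coord _ _ _)).
  apply: Ck_on_eq (IH _ (Df v) j) => // x Ux.
  by rewrite derive_mx ?mxE//; apply: diff_derivable; exact: df.
move=> H.
(* Conversely, [f] is the sum of its coordinates times the standard basis vectors. *)
have S := Ck_on_sum oU (fun j => Ck_onZl (delta_mx 0 j : 'rV[R]_m) oU (H j)).
by apply: Ck_on_eq S => // x _; rewrite -row_sum_delta.
Qed.

End Ck.

Lemma derive_comp (R : numFieldType) (V W X : normedModType R)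
    (f : W -> X) (g : V -> W) x v :
  differentiable g x -> differentiable f (g x) ->
  'D_v (f \o g) x = 'D_('D_v g x) f (g x).
Proof.
move=> dg df; have dfg := differentiable_comp dg df.
by rewrite (deriveE v dfg) (deriveE v dg) (deriveE _ df) (diff_comp dg df).
Qed.

Lemma derive_linear (R : numFieldType) (V W : normedModType R) (f : V -> W) x
    (a : R) u v :
  differentiable f x -> 'D_(a *: u + v) f x = a *: 'D_u f x + 'D_v f x.
Proof. by move=> df; rewrite !deriveE// linearP. Qed.

Lemma derive_rV (R : numFieldType) n (W : normedModType R) (f : 'rV[R]_n -> W)
    x v :
  differentiable f x -> 'D_v f x = \sum_i v 0 i *: 'D_('e_i) f x.
Proof.
move=> df; rewrite deriveE// {1}(row_sum_delta v) linear_sum.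
by apply: eq_bigr => i _; rewrite linearZ deriveE.
Qed.

(** The chain rule gives the derivative of [f] in the moving direction [D_v g]. Expanding this
    direction in the standard basis leaves only derivatives of [f] in constant directions, to which
    the induction hypothesis applies. *)
Lemma Ck_on_comp (R : realType) n m k (U : set 'rV[R]_n) (V : set 'rV[R]_m)
    (f : 'rV[R]_m -> R) (g : 'rV[R]_n -> 'rV[R]_m) :
  open U -> open V -> (forall x, U x -> V (g x)) ->
  Ck_on k V f -> Ck_on k U g -> Ck_on k U (f \o g).
Proof.
move=> oU oV UV; elim: k f => [|k IH] f.
  by move=> cf cg x Ux; apply: continuous_comp; [exact: cg|exact/cf/UV].
move=> kf kg; have [df Df] := kf; have [dg Dg] := kg; split=> [x Ux|v].
  by apply: differentiable_comp; [exact: dg|exact/df/UV].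
have T i : Ck_on k U (fun x => 'D_v g x 0 i * 'D_('e_i) f (g x)).
  apply: Ck_onM => //.
    exact: ((Ck_on_coordP k (fun x => 'D_v g x) oU).1 (Dg v) i).
  exact: IH (Df _) (Ck_onW kg).
apply: Ck_on_eq (Ck_on_sum oU T) => // x Ux.
have dfx := df _ (UV _ Ux).
by rewrite (derive_comp _ (dg _ Ux) dfx) (derive_rV _ dfx).
Qed.

Lemma derive_comp1 (R : realType) (V : normedModType R) (phi : R -> R)
    (l : V -> R) x v (d : R) :
  differentiable l x -> is_derive (l x) 1 phi d ->
  'D_v (phi \o l) x = 'D_v l x * d.
Proof.
move=> dl dphi.
have df : differentiable phi (l x).
  by apply/derivable1_diffP; exact: ex_derive.
rewrite derive_comp// deriveE// -[X in 'd _ _ X]mulr1 [LHS]linearZ /=.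
by rewrite -deriveE// derive_val.
Qed.

Section Smooth.
Variables (R : realType) (n : nat) (U : set 'rV[R]_n).
Hypothesis oU : open U.

Lemma smooth_differentiable (W : normedModType R) (f : 'rV[R]_n -> W) x :
  smooth_on U f -> U x -> differentiable f x.
Proof. by move=> /(_ 1%N)[+ _]; exact. Qed.

Lemma smooth_derive (W : normedModType R) (f : 'rV[R]_n -> W) v :
  smooth_on U f -> smooth_on U (fun x => 'D_v f x).
Proof. by move=> sf k; have [_] := sf k.+1; exact. Qed.

Lemma smooth_sub (W : normedModType R) V (f : 'rV[R]_n -> W) :
  V `<=` U -> smooth_on U f -> smooth_on V f.
Proof. by move=> VU sf k; exact: Ck_on_sub (sf k). Qed.

Lemma smooth_local (W : normedModType R) (f : 'rV[R]_n -> W) :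
  (forall x, U x -> exists2 V, V x & smooth_on V f) -> smooth_on U f.
Proof.
by move=> H k; apply: Ck_on_local => x /H[V Vx sf]; exists V; split.
Qed.

Lemma smooth_eq (W : normedModType R) (f g : 'rV[R]_n -> W) :
  (forall x, U x -> f x = g x) -> smooth_on U f -> smooth_on U g.
Proof. by move=> fg sf k; exact: Ck_on_eq (sf k). Qed.

Lemma smooth_cst (W : normedModType R) (a : W) : smooth_on U (fun=> a).
Proof. by move=> k; exact: Ck_on_cst. Qed.

Lemma smoothD (W : normedModType R) (f g : 'rV[R]_n -> W) :
  smooth_on U f -> smooth_on U g -> smooth_on U (fun x => f x + g x).
Proof. by move=> sf sg k; exact: Ck_onD. Qed.

Lemma smooth_sum (W : normedModType R) m (f : 'I_m -> 'rV[R]_n -> W) :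
  (forall i, smooth_on U (f i)) -> smooth_on U (fun x => \sum_i f i x).
Proof. by move=> sf k; apply: Ck_on_sum => // i; exact: sf. Qed.

Lemma smoothM (f g : 'rV[R]_n -> R) :
  smooth_on U f -> smooth_on U g -> smooth_on U (fun x => f x * g x).
Proof. by move=> sf sg k; exact: Ck_onM. Qed.

Lemma smoothB (f g : 'rV[R]_n -> R) :
  smooth_on U f -> smooth_on U g -> smooth_on U (fun x => f x - g x).
Proof.
move=> sf sg.
apply: smooth_eq (smoothD sf (smoothM (smooth_cst (-1 : R)) sg)) => x _.
by rewrite mulN1r.
Qed.

Lemma smoothV (f : 'rV[R]_n -> R) : (forall x, U x -> f x != 0) ->
  smooth_on U f -> smooth_on U (fun x => (f x)^-1).
Proof. by move=> f0 sf k; exact: Ck_onV. Qed.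

Lemma smooth_coord j : smooth_on U (fun x : 'rV[R]_n => x 0 j).
Proof. by move=> k; exact: Ck_on_coord. Qed.

Lemma smooth_coordP m (f : 'rV[R]_n -> 'rV[R]_m) :
  smooth_on U f <-> forall j, smooth_on U (fun x => f x 0 j).
Proof.
split=> [sf j k|sf k]; first exact: ((Ck_on_coordP _ _ oU).1 (sf k) j).
by apply/(Ck_on_coordP _ _ oU) => j; exact: sf.
Qed.

Lemma smooth_comp m (V : set 'rV[R]_m)
    (f : 'rV[R]_m -> R) (g : 'rV[R]_n -> 'rV[R]_m) :
  open V -> (forall x, U x -> V (g x)) ->
  smooth_on V f -> smooth_on U g -> smooth_on U (f \o g).
Proof. by move=> oV UV sf sg k; exact: Ck_on_comp (sf k) (sg k). Qed.

Section LinearFamily.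
Variables (H : 'rV[R]_n -> 'rV[R]_n -> R).
Hypothesis linH : forall x, U x -> forall a u v,
  H x (a *: u + v) = a * H x u + H x v.
Hypothesis smoothH : forall v, smooth_on U (fun x => H x v).

Lemma linear_family_sum x v : U x -> H x v = \sum_i v 0 i * H x 'e_i.
Proof.
move=> Ux; have H0 : H x 0 = 0.
  have := linH Ux 1 0 0.
  by rewrite scaler0 addr0 mul1r -{1}[H x 0]addr0 => /addrI.
rewrite {1}(row_sum_delta v).
by elim/big_rec2: _ => // i y1 y2 _ <-; rewrite linH.
Qed.

Lemma smooth_linear_family (X : 'rV[R]_n -> 'rV[R]_n) :
  smooth_on U X -> smooth_on U (fun x => H x (X x)).
Proof.
move=> /smooth_coordP sX.
apply: smooth_eq (smooth_sum (fun i => smoothM (sX i) (smoothH 'e_i))) => x Ux.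
by rewrite [RHS]linear_family_sum.
Qed.

(** Product rule for a linear form [H y] evaluated at a moving vector [X y]: one term moves the
    vector, the other moves the form with the vector frozen. *)
Lemma derive_linear_family (X : 'rV[R]_n -> 'rV[R]_n) x w :
  U x -> smooth_on U X ->
  'D_w (fun y => H y (X y)) x = H x ('D_w X x) + 'D_w (fun y => H y (X x)) x.
Proof.
move=> Ux sX; have /smooth_coordP sXi := sX.
(* This expansion is used for [X] and for the constant field [X x]; for the latter the derivatives
   of the components vanish. *)
have E (Y : 'rV[R]_n -> 'rV[R]_n) : smooth_on U Y ->
    'D_w (fun y => H y (Y y)) x =
    \sum_i (H x 'e_i * 'D_w (fun y => Y y 0 i) x
            + Y x 0 i * 'D_w (fun y => H y 'e_i) x).
  move=> /smooth_coordP sY.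
  have dY i : derivable (fun y => Y y 0 i) x w.
    exact: (diff_derivable (smooth_differentiable (sY i) Ux)).
  have dH i : derivable (fun y => H y 'e_i) x w.
    exact: (diff_derivable (smooth_differentiable (smoothH _) Ux)).
  have N : \near x, H x (Y x) =
      (\sum_i ((fun y => Y y 0 i) * (fun y => H y 'e_i))) x.
    apply: (near_open oU Ux) => y Uy.
    by rewrite linear_family_sum// fct_sumE.
  rewrite (near_eq_derive _ N) derive_sum; last by move=> i; exact: derivableM.
  by apply: eq_bigr => i _; rewrite deriveM// addrC.
rewrite (E _ sX) (E _ (smooth_cst (X x))) big_split /= [in RHS]big_split /=.
rewrite addrA; congr (_ + _).
rewrite [X in _ + X]big1 ?addr0; last first.
  by move=> i _; rewrite derive_cst mulr0.
rewrite linear_family_sum//; apply: eq_bigr => i _.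
rewrite derive_mx ?mxE 1?mulrC//.
exact: (diff_derivable (smooth_differentiable sX Ux)).
Qed.

End LinearFamily.

Lemma derive_derive_along (f : 'rV[R]_n -> R) (X : 'rV[R]_n -> 'rV[R]_n) x w :
  U x -> smooth_on U f -> smooth_on U X ->
  'D_w (fun y => 'D_(X y) f y) x =
  'D_('D_w X x) f x + 'D_w (fun y => 'D_(X x) f y) x.
Proof.
move=> Ux sf; apply: (@derive_linear_family (fun x v => 'D_v f x)) => //.
  move=> y Uy a u v.
  exact: (derive_linear _ _ _ (smooth_differentiable sf Uy)).
by move=> v; exact: smooth_derive.
Qed.

End Smooth.

(** * Bump functions *)

Section Flat.
Variable R : realType.

(** The family in [n] is closed under differentiation up to linear combinations, so smoothness of
    [exp (-1/t)] extended by 0 follows by one induction over all its members. *)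
Definition flat (n : nat) (t : R) : R :=
  if 0 < t then t^-1 ^+ n * expR (- t^-1) else 0.

Lemma flat_gt0 n t : 0 < t -> 0 < flat n t.
Proof.
by move=> t0; rewrite /flat t0 mulr_gt0 ?expR_gt0// exprn_gt0// invr_gt0.
Qed.

Lemma flat_le0 n t : t <= 0 -> flat n t = 0.
Proof. by move=> t0; rewrite /flat ltNge t0. Qed.

Lemma flat_ge0 n t : 0 <= flat n t.
Proof.
by have [/(flat_le0 n)->|/(flat_gt0 n)/ltW] := leP t 0.
Qed.

(** For [t > 0] the term of degree [n + 2] in the series of [exp (1/t)] bounds it from below. The
    two extra powers leave a factor [t^2], which forces derivative 0 at the origin. *)
Lemma flat_bound n t : flat n t <= n.+2`!%:R * t ^+ 2.
Proof.
have [t0|t0] := leP t 0.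
  by rewrite flat_le0// mulr_ge0// sqr_ge0.
have tn : t != 0 by rewrite gt_eqF.
have fpos : 0 < (n.+2)`!%:R :> R by rewrite ltr0n fact_gt0.
rewrite /flat t0 expRN ler_pdivrMr ?expR_gt0//.
have H : t^-1 ^+ n.+2 / n.+2`!%:R <= expR t^-1.
  apply: le_trans (expR_ge1Dxn n.+1 _); last by rewrite invr_ge0 ltW.
  by rewrite lerDr.
rewrite (_ : t^-1 ^+ n = n.+2`!%:R * t ^+ 2 * (t^-1 ^+ n.+2 / n.+2`!%:R)).
  by rewrite ler_wpM2l// mulr_ge0// ?sqr_ge0// ler0n.
rewrite !exprSr; set a := t^-1 ^+ n.
by field; rewrite tn gt_eqF.
Qed.

Lemma is_derive_flat n (t : R) :
  is_derive t 1 (flat n) (flat n.+2 t - n%:R * flat n.+1 t).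
Proof.
have [t0|t0|t0] := ltgtP t 0.
- rewrite !flat_le0 ?ltW// mulr0 subr0.
  apply: (@near_eq_is_derive _ _ _ (cst 0)).
  near=> s; rewrite /= flat_le0// ltW//; near: s.
  exact: lt_nbhsl.
- apply: (@near_eq_is_derive _ _ _ (fun s : R => s^-1 ^+ n * expR (- s^-1))).
    near=> s; rewrite /flat ifT//; near: s.
    exact: lt_nbhsr.
  have tn : t != 0 by rewrite gt_eqF.
  have dV : is_derive t 1 (fun s : R => s^-1) (- t^-1 ^+ 2 : R).
    apply: DeriveDef; first exact: (@derivableV _ _ id).
    rewrite (@deriveV _ _ id)//.
    by rewrite derive_id exprVn scaleNr [_ *: _]mulr1.
  (* The function is [p] at [y = 1/t]; the inner derivative [- t^-2] raises the exponents [n - 1]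
     and [n] to [n + 1] and [n + 2]. *)
  pose p (y : R) : R := y ^+ n * expR (- y).
  have dp : is_derive t^-1 1 p
     (n%:R * t^-1 ^+ n.-1 * expR (- t^-1) - t^-1 ^+ n * expR (- t^-1)).
    have dN : is_derive t^-1 1 (fun y : R => expR (- y)) (expR (- t^-1) * -1).
      exact: (@is_derive1_comp _ expR -%R).
    have dX : is_derive t^-1 1 ((id : R -> R) ^+ n)
        ((n%:R * t^-1 ^+ n.-1) *: (1 : R)).
      exact: is_deriveX.
    have -> : p = (id : R -> R) ^+ n * (fun y : R => expR (- y)).
      by apply/funext => y; rewrite /p !fctE.
    apply: is_derive_eq (is_deriveM dX dN) _.
    rewrite !fctE /GRing.scale /=; ring.
  apply: (is_derive_eq (is_derive1_comp dp dV)).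
  (* The case [n = 0] is apart because [n.-1] is then truncated to 0; its coefficient is 0
     anyway. *)
  rewrite /flat t0; case: n @p dp => [|m] p dp /=; first by ring.
  rewrite !(exprS _ m.+2) !(exprS _ m.+1) !(exprS _ m) -natr1.
  set u := t^-1; set e := expR _; set w := u ^+ m; ring.
- rewrite t0 !flat_le0// mulr0 subr0.
  have f0 : flat n \o shift 0 = cst (flat n 0) + (0 : R -> R) +o_ (0 : R) id.
    apply/eqaddoP => eps eps0; near=> h.
    rewrite !fctE /= addr0 (@flat_le0 _ 0)//.
    rewrite -[leLHS]/(`|flat n h - (0 + 0)|) addr0 subr0 ger0_norm ?flat_ge0//.
    (* With [C = (n+2)!], the bound [C h^2] is at most [eps |h|] once [|h| <= eps / C]. *)
    apply: le_trans (flat_bound n h) _.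
    rewrite -normr_id -(ger0_norm (sqr_ge0 h)) normrX expr2 mulrA.
    rewrite !normr_id ler_wpM2r// -ler_pdivlMl ?ltr0n ?fact_gt0//.
    near: h; apply: (@nbhs0_le R R).
    by rewrite mulr_gt0// invr_gt0 ltr0n fact_gt0.
  have c0 : continuous (\0 : R -> R) by exact: cst_continuous.
  have d0 : 'd (flat n) (0 : R) = \0 :> (R -> R) by apply: diff_unique.
  have df : differentiable (flat n) (0 : R).
    by apply/diff_locallyP; rewrite d0.
  by apply: DeriveDef; [exact: diff_derivable|rewrite deriveE// d0].
Unshelve. all: by end_near. Qed.

Lemma Ck_on_flat (m n k : nat) (U : set 'rV[R]_n) (l : 'rV[R]_n -> R) :
  open U -> Ck_on k U l -> Ck_on k U (flat m \o l).
Proof.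
move=> oU; elim: k m => [|k IH] m.
  move=> cl x Ux; apply: continuous_comp; first exact: cl.
  apply: differentiable_continuous; apply/derivable1_diffP.
  by apply: ex_derive; exact: is_derive_flat.
move=> kl; have [dl Dl] := kl; split=> [x Ux|v].
  apply: differentiable_comp; first exact: dl.
  apply/derivable1_diffP.
  by apply: ex_derive; exact: is_derive_flat.
have B := Ck_onM oU (Ck_on_cst k U (- m%:R : R)) (IH m.+1 (Ck_onW kl)).
have D := Ck_onD oU (IH m.+2 (Ck_onW kl)) B.
apply: Ck_on_eq (Ck_onM oU (Dl v) D) => // x Ux.
rewrite (derive_comp1 v (dl x Ux) (is_derive_flat m _)) /=.
by rewrite mulNr.
Qed.

End Flat.

Section Bump.
Variables (R : realType) (n : nat).

(** The usual smooth transition from 0 to 1; the denominator never vanishes because [t] and [1 - t]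
    are not both nonpositive. *)
Definition step (t : R) : R := flat 0 t / (flat 0 t + flat 0 (1 - t)).

Lemma step_den_gt0 (t : R) : 0 < flat 0 t + flat 0 (1 - t).
Proof.
have [t0|t0] := leP t 0.
  by rewrite ltr_wpDl ?flat_ge0// flat_gt0// subr_gt0 (le_lt_trans t0).
by rewrite ltr_wpDr ?flat_ge0// flat_gt0.
Qed.

Lemma step_le0 (t : R) : t <= 0 -> step t = 0.
Proof. by move=> t0; rewrite /step flat_le0// mul0r. Qed.

Lemma step_ge1 (t : R) : 1 <= t -> step t = 1.
Proof.
move=> t1; have := step_den_gt0 t; rewrite /step.
rewrite (@flat_le0 _ _ (1 - t)) ?subr_le0// addr0 => h.
by rewrite divff// gt_eqF.
Qed.

Lemma smooth_step (U : set 'rV[R]_n) (l : 'rV[R]_n -> R) :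
  open U -> smooth_on U l -> smooth_on U (step \o l).
Proof.
move=> oU sl.
have s0 : smooth_on U (flat 0 \o l) by move=> k; exact: Ck_on_flat.
have s1 : smooth_on U (flat 0 \o (fun x => 1 - l x)).
  move=> k; apply: Ck_on_flat => //.
  exact: (smoothB oU (smooth_cst U (1 : R)) sl k).
apply: (smoothM oU s0); apply: smoothV => //.
  by move=> x _; rewrite gt_eqF ?step_den_gt0.
exact: (smoothD oU s0 s1).
Qed.

Lemma norm_rV_le (x : 'rV[R]_n) (r : R) : 0 <= r ->
  (forall i, `|x 0 i| <= r) -> `|x| <= r.
Proof.
move=> r0 H; rewrite /Num.Def.normr/= mx_normrE (bigmax_le _ r0)//= => -[i j] _.
by rewrite ord1.
Qed.

(** The support is bounded coordinate by coordinate so that it lies in a product of segments, which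
    is compact. *)
Lemma euclid_bump (a : 'rV[R]_n) (r : R) : 0 < r -> exists chi : 'rV[R]_n -> R,
  [/\ smooth_on setT chi, \near a, chi a = 1
    & forall x, chi x != 0 -> forall i, `|x 0 i - a 0 i| <= r].
Proof.
move=> r0; pose q (x : 'rV[R]_n) := \sum_i (x 0 i - a 0 i) * (x 0 i - a 0 i).
have sq : smooth_on setT q.
  apply: (smooth_sum openT) => i; apply: smoothM; first exact: openT.
    exact: (smoothB openT (smooth_coord _ _) (smooth_cst _ (a 0 i))).
  exact: (smoothB openT (smooth_coord _ _) (smooth_cst _ (a 0 i))).
(* With [q] the squared Euclidean distance to [a], this is at least 1 when [q <= r^2 / 2] and
   positive only when [q < r^2]. *)
pose l x := 2 - 2 / r ^+ 2 * q x.
have sl : smooth_on setT l.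
  apply: (smoothB openT (smooth_cst _ (2 : R))).
  exact: (smoothM openT (smooth_cst _ (2 / r ^+ 2)) sq).
exists (step \o l); split.
- exact: smooth_step openT sl.
- have cl : {for a, continuous l} by exact: (sl 0%N).
  have la : 1 < l a.
    by rewrite /l /q big1 ?mulr0 ?subr0 ?ltr1n// => i _; rewrite subrr mulr0.
  have := cl [set y | 1 < y] (lt_nbhsr la).
  apply: (@filterS _ (nbhs a)) => x /= /ltW.
  exact: step_ge1.
- move=> x /= nz; have lx : 0 < l x.
    by rewrite ltNge; apply: contra nz => /step_le0 ->.
  have qx : q x < r ^+ 2.
    have r2 : 0 < r ^+ 2 by rewrite exprn_gt0.
    move: lx; rewrite /l subr_gt0 mulrAC ltr_pdivrMr//; lra.
  move=> i; rewrite -(ler_pXn2r (ltn0Sn 1)) ?nnegrE ?(ltW r0)//.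
  rewrite -normrX ger0_norm ?sqr_ge0//; apply: le_trans (ltW qx).
  rewrite /q (bigD1 i)//= -expr2 lerDl sumr_ge0// => j _.
  by rewrite -expr2 sqr_ge0.
Qed.

End Bump.

(** * Symmetry of second derivatives *)

Section Schwarz.
Variables (R : realType) (n : nat).

Lemma differentiable_id (V : normedModType R) (x : V) : differentiable id x.
Proof. by []. Qed.

Lemma is_derive_line (f : 'rV[R]_n -> R) (y w : 'rV[R]_n) (s : R) :
  differentiable f (s *: w + y) ->
  is_derive s 1 (fun s : R => f (s *: w + y)) ('D_w f (s *: w + y)).
Proof.
move=> df; pose g (s : R) := s *: w + y.
have dz : differentiable (fun s : R => s *: w) s.
  exact: (differentiableZl w (@differentiable_id _ _)).
have dg : differentiable g s by exact: (differentiableD dz).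
have eg : 'D_1 g s = w.
  have dv : derivable (fun s : R => s *: w) s 1 by exact: diff_derivable.
  rewrite [LHS](deriveD dv (derivable_cst y _ _)).
  by rewrite derive_cst addr0 (deriveE _ dz) diffZl// diff_val scale1r.
apply: DeriveDef.
  exact: (diff_derivable (differentiable_comp dg df)).
by rewrite (derive_comp _ dg df) eg.
Qed.

Lemma mvt_line (f : 'rV[R]_n -> R) (y w : 'rV[R]_n) (h : R) : 0 < h ->
  (forall s, 0 <= s <= h -> differentiable f (s *: w + y)) ->
  exists2 c, 0 <= c <= h & f (h *: w + y) - f y = 'D_w f (c *: w + y) * h.
Proof.
move=> h0 df.
have [c|c|c ch E] := @MVT R (fun s : R => f (s *: w + y))
  (fun s => 'D_w f (s *: w + y)) 0 h h0.
- rewrite in_itv/= => /andP[c0 ch]; apply: is_derive_line.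
  by apply: df; rewrite !ltW.
- apply: derivable_within_continuous => t; rewrite in_itv/= => th.
  exact: (@ex_derive _ _ _ _ _ _ _ (is_derive_line (df _ th))).
exists c; first by move: ch; rewrite in_itv/= => /andP[/ltW-> /ltW->].
by move: E; rewrite scale0r add0r subr0.
Qed.

(** Two applications of the mean value theorem: along [u] to the increment of [f] under translation
    by [h *: v], then along [v] to [D_u f]. *)
Lemma second_difference U (f : 'rV[R]_n -> R) x u v :
  open U -> U x -> Ck_on 2 U f -> exists2 d : R, 0 < d &
    forall h, 0 < h < d -> exists2 p, U p &
      f (h *: u + (h *: v + x)) - f (h *: u + x) - (f (h *: v + x) - f x)
      = 'D_v (fun y => 'D_u f y) p * h * h.
Proof.
move=> oU Ux [df Df].
have /nbhs_normP[r /= r0 rU] : nbhs x U by exact: open_nbhs_nbhs.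
have D0 : 0 < `|u| + `|v| + 1 by rewrite ltr_wpDl// addr_ge0.
(* Keeps the parallelogram spanned by [h *: u] and [h *: v] at [x] inside the ball of radius [r];
   the 1 prevents a zero denominator. *)
exists (r / (`|u| + `|v| + 1)); first by rewrite divr_gt0.
move=> h /andP[h0]; rewrite ltr_pdivlMr// => hd.
have inU s t : 0 <= s <= h -> 0 <= t <= h -> U (s *: u + (t *: v + x)).
  move=> /andP[s0 sh] /andP[t0 th]; apply: rU => /=.
  rewrite -normrN opprB addrA addrK (le_lt_trans (ler_normD _ _))//.
  rewrite !normrZ !ger0_norm//; apply: le_lt_trans hd.
  have := ler_wpM2r (normr_ge0 u) sh; have := ler_wpM2r (normr_ge0 v) th.
  nra.
have hh : 0 <= h <= h by rewrite lexx ltW.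
have h00 : 0 <= (0 : R) <= h by rewrite lexx ltW.
have inU0 s : 0 <= s <= h -> U (s *: u + x).
  by move=> sh; have := inU _ _ sh h00; rewrite scale0r add0r.
pose sh z := h *: v + z.
have dsh z : differentiable sh z.
  exact: (differentiableD (@differentiable_cst _ _ _ (h *: v) z)
    (@differentiable_id _ _)).
have Dsh z : 'D_u sh z = u.
  rewrite [LHS](deriveD (derivable_cst (h *: v) _ _) (@derivable_id _ _ _ _)).
  by rewrite derive_cst add0r derive_id.
have dfs s : 0 <= s <= h -> differentiable (f \o sh) (s *: u + x).
  move=> sH; apply: differentiable_comp; first exact: dsh.
  by apply: df; rewrite /sh addrCA; exact: inU.
have dfx s : 0 <= s <= h -> differentiable f (s *: u + x).
  by move=> sH; exact: df (inU0 _ sH).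
have [|c ch E] := @mvt_line (f \o sh - f) x u h h0.
  by move=> s sH; apply: differentiableB; [exact: dfs|exact: dfx].
have ec : 'D_u (f \o sh - f) (c *: u + x) =
    'D_u f (h *: v + (c *: u + x)) - 'D_u f (c *: u + x).
  rewrite deriveB; [|exact/diff_derivable/dfs|exact/diff_derivable/dfx].
  have dfc : differentiable f (sh (c *: u + x)).
    by apply: df; rewrite /sh addrCA; exact: inU.
  by rewrite (derive_comp _ (dsh _) dfc) Dsh.
have [|c' c'h E'] := @mvt_line (fun y => 'D_u f y) (c *: u + x) v h h0.
  by move=> s sH; apply: (Df u).1; rewrite addrCA; exact: inU.
exists (c' *: v + (c *: u + x)); first by rewrite addrCA; exact: inU.
rewrite -E' -ec -E !fctE /= /sh.
by rewrite [h *: v + (_ + _)]addrCA; ring.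
Qed.

(** The points [p] and [q] may differ: continuity is applied to each function separately, and
    [|a x - b x|] is then at most any positive [e]. This fits the mean value theorem, whose
    intermediate points are not under control. *)
Lemma continuous_eq_at (T : topologicalType) (a b : T -> R) (x : T) :
  {for x, continuous a} -> {for x, continuous b} ->
  (forall V, open V -> V x -> exists p q, [/\ V p, V q & a p = b q]) ->
  a x = b x.
Proof.
move=> ca cb H; apply/eqP; rewrite -subr_eq0 -normr_eq0 eq_le normr_ge0 andbT.
apply/ler_addgt0Pl => e e0; rewrite addr0.
have e2 : 0 < e / 2 by rewrite divr_gt0.
have /cvgrPdist_lt/(_ _ e2) N1 := ca.
have /cvgrPdist_lt/(_ _ e2) N2 := cb.
have N : (interior ((fun t => `|a x - a t| < e / 2) `&`
    (fun t => `|b x - b t| < e / 2))) x by exact: filterI.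
have [p [q [Vp Vq E]]] := H _ (@open_interior _ _) N.
have [B1 _] := interior_subset Vp; have [_ B2] := interior_subset Vq.
move: B1 B2; rewrite E !ltr_norml ler_norml; lra.
Qed.

(** The second difference is symmetric in [u] and [v]. Divided by [h^2] it is a value of either
    mixed derivative at some point close to [x], and both are continuous there. *)
Lemma derive_comm U (f : 'rV[R]_n -> R) x u v :
  open U -> U x -> Ck_on 2 U f ->
  'D_u (fun y => 'D_v f y) x = 'D_v (fun y => 'D_u f y) x.
Proof.
move=> oU Ux kf.
have cont w w' : {for x, continuous (fun y => 'D_w (fun y => 'D_w' f y) y)}.
  by have [_ /(_ w')[_ /(_ w)]] := kf; exact.
apply: (continuous_eq_at (cont u v) (cont v u)) => V oV Vx.
have oW : open (U `&` V) by exact: openI.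
have Wx : (U `&` V) x by [].
have kV : Ck_on 2 (U `&` V) f by apply: Ck_on_sub kf => y [].
have [d1 d10 H1] := second_difference u v oW Wx kV.
have [d2 d20 H2] := second_difference v u oW Wx kV.
pose h := Num.min d1 d2 / 2.
have m0 : 0 < Num.min d1 d2 by rewrite lt_min d10.
have h0 : 0 < h by rewrite divr_gt0.
have hm : h < Num.min d1 d2 by rewrite ltr_pdivrMr// ltr_pMr// ltr1n.
move: hm; rewrite lt_min => /andP[hd1 hd2].
have [|p [_ Vp] E1] := H1 h; first by rewrite h0.
have [|p' [_ Vp'] E2] := H2 h; first by rewrite h0.
exists p', p; split; [exact: Vp'|exact: Vp|].
have hn : h != 0 by rewrite gt_eqF.
apply: (mulIf hn); apply: (mulIf hn); apply: (etrans (esym E2) (etrans _ E1)).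
by rewrite [h *: v + (h *: u + x)]addrCA; ring.
Qed.

End Schwarz.

(** * Charts and vector fields *)

Section Charts.
Variables (R : realType) (M : topologicalType) (n : nat) (c : chart R M n).
Hypothesis hc : is_chart c.

Lemma chart_img_map p : chart_dom c p -> chart_img c (chart_map c p).
Proof. by move=> cp; exists p. Qed.

Lemma chart_inv_dom x : chart_img c x -> chart_dom c (chart_inv c x).
Proof. by move=> [p cp <-]; have [_ _ _ _ ->] := hc. Qed.

Lemma chart_mapK p : chart_dom c p -> chart_inv c (chart_map c p) = p.
Proof. by have [_ _ _ _] := hc; exact. Qed.

Lemma chart_invK x : chart_img c x -> chart_map c (chart_inv c x) = x.
Proof. by move=> [p cp <-]; rewrite chart_mapK. Qed.

Lemma chart_img_open : open (chart_img c).
Proof. by have [] := hc. Qed.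

Lemma open_chart_preimage (V : set M) : open V ->
  open (chart_img c `&` chart_inv c @^-1` V).
Proof.
have [_ oI _ cI _] := hc; move: cI.
by rewrite continuous_open_subspace// => /(continuous_inP _ oI); exact.
Qed.

(** Presents the domain of a transition map as a preimage, whose openness is given by
    [open_chart_preimage]. *)
Lemma chart_map_image (V : set M) :
  chart_map c @` (chart_dom c `&` V) = chart_img c `&` chart_inv c @^-1` V.
Proof.
apply/seteqP; split=> [_ [p [cp Vp] <-]|x [Ix Vx]].
  by split; [exact: chart_img_map|rewrite /preimage /= chart_mapK].
by exists (chart_inv c x); [split=> //; exact: chart_inv_dom|exact: chart_invK].
Qed.

End Charts.

Section Manifold.
Variables (R : realType) (M : topologicalType) (n : nat).
Variable A : set (chart R M n).
Hypothesis hA : smooth_manifold A.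
Implicit Types (c d : chart R M n) (X Y Z : M -> tvector R M).

Lemma atlas_chart c : A c -> is_chart c.
Proof. by have [_ _ H _ _] := hA; exact: H. Qed.

Lemma atlas_cover p : exists2 c, A c & chart_dom c p.
Proof. by have [_ _ _ H _] := hA; exact: H. Qed.

Definition overlap c d := chart_img d `&` chart_inv d @^-1` chart_dom c.

Lemma overlap_open c d : A c -> A d -> open (overlap c d).
Proof.
move=> Ac Ad; apply: open_chart_preimage; first exact: atlas_chart.
by have [] := atlas_chart Ac.
Qed.

Lemma transition_smooth c d : A c -> A d ->
  smooth_on (overlap c d) (chart_map c \o chart_inv d).
Proof.
move=> Ac Ad; have [_ _ _ _ /(_ _ _ Ad Ac)] := hA.
by rewrite /smooth_transition chart_map_image//; exact: atlas_chart.
Qed.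

Lemma transition_img c d x : overlap c d x ->
  chart_img c ((chart_map c \o chart_inv d) x).
Proof. by move=> [_ cx]; exact: chart_img_map. Qed.

(** A bump function in the chart, extended by 0. The extension is smooth because the support lies in
    a compact subset of the chart domain, and this subset is closed since [M] is Hausdorff. *)
Lemma exists_cutoff c p : A c -> chart_dom c p ->
  exists V (chi : M -> R), [/\ open V, V `<=` chart_img c, V (chart_map c p),
    forall x, V x -> chi (chart_inv c x) = 1 &
    [/\ forall q, ~ chart_dom c q -> chi q = 0 &
    forall phi, smooth_on (chart_img c) phi ->
      smooth_fun A (fun q => chi q * phi (chart_map c q))]].
Proof.
move=> Ac cp; have hc := atlas_chart Ac; have oI := chart_img_open hc.
set a := chart_map c p; have Ia : chart_img c a by exact: chart_img_map.
have /nbhs_normP[r /= r0 rI] : nbhs a (chart_img c) by exact: open_nbhs_nbhs.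
have r20 : 0 < r / 2 by rewrite divr_gt0.
have [chi0 [schi0 chi1 chis]] := euclid_bump a r20.
(* A closed box around [a]: compact, inside the chart image, and containing the support of
   [chi0]. *)
pose K0 := [set x : 'rV[R]_n | forall i,
  x 0 i \in `[(a 0 i - r / 2), (a 0 i + r / 2)]].
have K0I : K0 `<=` chart_img c.
  move=> x K0x; apply: rI => /=; apply: (@le_lt_trans _ _ (r / 2)).
    apply: norm_rV_le => [|i]; first exact: ltW.
    by have := K0x i; rewrite !mxE in_itv/= ler_norml => /andP[? ?]; lra.
  by rewrite ltr_pdivrMr// ltr_pMr// ltr1n.
have cK0 : compact K0.
  apply: (@rV_compact _ _
    (fun i => `[(a 0 i - r / 2), (a 0 i + r / 2)]%classic)).
  by move=> i; exact: segment_compact.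
pose K := chart_inv c @` K0.
have oK : open (~` K).
  apply: closed_openC; have [hM _ _ _ _] := hA.
  apply: (compact_closed hM); apply: continuous_compact => //.
  by have [_ _ _ cI _] := hc; exact: continuous_subspaceW K0I cI.
have K0P x : chi0 x != 0 -> K0 x.
  move=> /chis H i; have := H i.
  by rewrite in_itv/= ler_norml => /andP[? ?]; apply/andP; split; lra.
pose chi q := if `[< chart_dom c q >] then chi0 (chart_map c q) else 0.
exists (interior [set x | chi0 x = 1] `&` chart_img c), chi; split.
- by apply: openI => //; exact: open_interior.
- by move=> x [].
- by split.
- move=> x [/interior_subset + Ix]; rewrite /chi asboolT ?chart_invK//.
  exact: chart_inv_dom.
split=> [q cq|phi sphi]; first by rewrite /chi asboolF.
move=> d Ad; apply: smooth_local => x Ix.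
have oO := overlap_open Ac Ad.
(* At a point of the domain of [c], the function is read through the transition map; at any other
   point, it vanishes on the complement of [K], which is an open neighbourhood. *)
have [cx|ncx] := pselect (chart_dom c (chart_inv d x)).
  exists (overlap c d); first by [].
  have s1 : smooth_on (chart_img c) (fun y => chi0 y * phi y).
    by apply: (smoothM oI) => //; exact: smooth_sub schi0.
  have s2 := transition_smooth Ac Ad.
  apply: (smooth_eq oO) (smooth_comp oO oI (@transition_img c d) s1 s2).
  by move=> y [Iy cy] /=; rewrite /chi asboolT.
have oV := open_chart_preimage (atlas_chart Ad) oK.
exists (chart_img d `&` chart_inv d @^-1` (~` K)).
  split=> // -[y K0y E]; apply: ncx; rewrite -E.
  by apply: chart_inv_dom => //; exact: K0I.
apply: (smooth_eq oV) (smooth_cst _ (0 : R)) => y [Iy nKy] /=.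
rewrite /chi; case: asboolP => [cy|]; last by rewrite mul0r.
have [->|/K0P Ky] := eqVneq (chi0 (chart_map c (chart_inv d y))) 0.
  by rewrite mul0r.
by case: nKy; eexists; [exact: Ky|rewrite chart_mapK].
Qed.

Lemma coord_tvectorE c p u h : smooth_fun A h ->
  coord_tvector A c p u h = 'D_u (h \o chart_inv c) (chart_map c p).
Proof. by move=> sh; rewrite /coord_tvector asboolT. Qed.

Lemma coord_tvector_nonsmooth c p u h : ~ smooth_fun A h ->
  coord_tvector A c p u h = 0.
Proof. by move=> sh; rewrite /coord_tvector asboolF. Qed.

Lemma smooth_fun_differentiable c h x : A c -> smooth_fun A h ->
  chart_img c x -> differentiable (h \o chart_inv c) x.
Proof. by move=> Ac sh; exact: smooth_differentiable (sh _ Ac). Qed.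

Lemma coord_tvector_linear c p a u v : A c -> chart_dom c p ->
  coord_tvector A c p (a *: u + v) =
  a *: coord_tvector A c p u + coord_tvector A c p v.
Proof.
move=> Ac cp; apply/funext => h; rewrite !fctE.
have [sh|sh] := pselect (smooth_fun A h); last first.
  by rewrite !coord_tvector_nonsmooth// scaler0 addr0.
rewrite !coord_tvectorE//; apply: derive_linear.
by apply: smooth_fun_differentiable => //; exact: chart_img_map.
Qed.

Lemma coord_tvector0 c p : coord_tvector A c p 0 = 0.
Proof.
apply/funext => h; have [sh|sh] := pselect (smooth_fun A h); last first.
  by rewrite coord_tvector_nonsmooth.
by rewrite coord_tvectorE// derive0.
Qed.

Lemma coord_tvectorZ c p a u : A c -> chart_dom c p ->
  coord_tvector A c p (a *: u) = a *: coord_tvector A c p u.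
Proof.
move=> Ac cp; rewrite -[a *: u]addr0 coord_tvector_linear//.
by rewrite coord_tvector0 addr0.
Qed.

(** Chain rule: near the point, [h \o chart_inv d] is [h \o chart_inv c] composed with the
    transition map. *)
Lemma coord_tvector_change c d p u : A c -> A d ->
  chart_dom c p -> chart_dom d p ->
  coord_tvector A d p u =
  coord_tvector A c p ('D_u (chart_map c \o chart_inv d) (chart_map d p)).
Proof.
move=> Ac Ad cp dp; apply/funext => h.
have hc := atlas_chart Ac; have hd := atlas_chart Ad.
have [sh|sh] := pselect (smooth_fun A h); last first.
  by rewrite !coord_tvector_nonsmooth.
have Op : overlap c d (chart_map d p).
  by split; [exact: chart_img_map|rewrite /preimage /= chart_mapK].
rewrite !coord_tvectorE//.
have E : (chart_map c \o chart_inv d) (chart_map d p) = chart_map c p.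
  by rewrite /= chart_mapK.
have dt := smooth_differentiable (transition_smooth Ac Ad) Op.
have dh : differentiable (h \o chart_inv c)
    ((chart_map c \o chart_inv d) (chart_map d p)).
  by rewrite E; apply: smooth_fun_differentiable => //; exact: chart_img_map.
rewrite -[in RHS]E -(derive_comp _ dt dh); apply: near_eq_derive.
apply: (near_open (overlap_open Ac Ad) Op) => y [Iy cy] /=.
by rewrite chart_mapK.
Qed.

Lemma tangentP c p v : A c -> chart_dom c p ->
  tangent A p v <-> exists u, v = coord_tvector A c p u.
Proof.
move=> Ac cp; split=> [[d [u [Ad dp ->]]]|[u ->]]; last by exists c, u.
by eexists; exact: (coord_tvector_change u Ac Ad cp dp).
Qed.

Lemma tangent_coord c p u : A c -> chart_dom c p ->
  tangent A p (coord_tvector A c p u).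
Proof. by move=> Ac cp; apply/(tangentP _ Ac cp); exists u. Qed.

Lemma tangent0 p : tangent A p 0.
Proof.
have [c Ac cp] := atlas_cover p.
by apply/(tangentP _ Ac cp); exists 0; rewrite coord_tvector0.
Qed.

Definition local_rep c X (x : 'rV[R]_n -> 'rV[R]_n) :=
  forall y, chart_img c y ->
    X (chart_inv c y) = coord_tvector A c (chart_inv c y) (x y).

Lemma local_rep_exists c X : A c -> vector_field A X ->
  exists x, local_rep c X x.
Proof.
move=> Ac [tX _].
suff /choice[x xP] : forall y, exists u, chart_img c y ->
  X (chart_inv c y) = coord_tvector A c (chart_inv c y) u by exists x.
move=> y; have [Iy|nIy] := pselect (chart_img c y); last by exists 0.
have cy := chart_inv_dom (atlas_chart Ac) Iy.
by have /(tangentP _ Ac cy)[u ->] := tX (chart_inv c y); exists u.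
Qed.

Lemma local_rep_vact c X x h y : A c -> local_rep c X x -> smooth_fun A h ->
  chart_img c y -> vact X h (chart_inv c y) = 'D_(x y) (h \o chart_inv c) y.
Proof.
move=> Ac Xx sh Iy; rewrite /vact Xx// coord_tvectorE// chart_invK//.
exact: atlas_chart.
Qed.

(** The [j]-th component of [x] is [X] applied to the [j]-th coordinate. A cut-off equal to 1 near
    the point makes this coordinate a smooth function on all of [M]. *)
Lemma local_rep_smooth c X x : A c -> vector_field A X -> local_rep c X x ->
  smooth_on (chart_img c) x.
Proof.
move=> Ac [tX sX] Xx; have hc := atlas_chart Ac; have oI := chart_img_open hc.
apply/(smooth_coordP oI) => j; apply: smooth_local => y0 Iy0.
have cy0 := chart_inv_dom hc Iy0.
have [V [chi [oV VI Vy chi1 [_ chiP]]]] := exists_cutoff Ac cy0.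
rewrite chart_invK// in Vy.
exists V => //.
have sh := chiP _ (smooth_coord _ j).
have sD : smooth_on V
    (vact X (fun q => chi q * chart_map c q 0 j) \o chart_inv c).
  exact: (smooth_sub VI (sX _ sh c Ac)).
apply: (smooth_eq oV) sD => y Vy'; have Iy := VI _ Vy'.
rewrite /= (local_rep_vact Ac Xx sh Iy) -[RHS](derive_coord y).
apply: near_eq_derive; apply: (near_open oV Vy') => z Vz /=.
by rewrite chi1// mul1r chart_invK//; exact: VI.
Qed.

(** The coordinate field with constant component [u], times a cut-off, is a global vector field. One
    cut-off serves all [u], hence [V] does not depend on [u]. *)
Lemma local_frame c p : A c -> chart_dom c p ->
  exists V, [/\ open V, V `<=` chart_img c, V (chart_map c p) &
    forall u, exists X x, [/\ vector_field A X, local_rep c X x &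
      forall y, V y -> x y = u]].
Proof.
move=> Ac cp; have hc := atlas_chart Ac.
have [V [chi [oV VI Vy chi1 [chi0 chiP]]]] := exists_cutoff Ac cp.
exists V; split => // u.
exists (fun q => chi q *: coord_tvector A c q u),
  (fun y => chi (chart_inv c y) *: u).
split; last by move=> y Vy'; rewrite chi1// scale1r.
  split=> [q|h sh].
    have [cq|cq] := pselect (chart_dom c q).
      by rewrite -coord_tvectorZ//; exact: tangent_coord.
    by rewrite chi0// scale0r; exact: tangent0.
  suff -> : vact (fun q => chi q *: coord_tvector A c q u) h =
      (fun q => chi q * 'D_u (h \o chart_inv c) (chart_map c q)).
    exact: (chiP (fun y => 'D_u (h \o chart_inv c) y)
      (smooth_derive u (sh _ Ac))).
  by apply/funext => q; rewrite /vact !fctE coord_tvectorE.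
by move=> y Iy; rewrite coord_tvectorZ//; exact: chart_inv_dom.
Qed.

End Manifold.

Section SmoothFun.
Variables (R : realType) (M : topologicalType) (n : nat).
Variable A : set (chart R M n).
Hypothesis hA : smooth_manifold A.

Lemma smooth_funD (h k : M -> R) : smooth_fun A h -> smooth_fun A k ->
  smooth_fun A (fun p => h p + k p).
Proof.
move=> sh sk c Ac; have oI := chart_img_open (atlas_chart hA Ac).
exact: (smoothD oI (sh _ Ac) (sk _ Ac)).
Qed.

Lemma smooth_funB (h k : M -> R) : smooth_fun A h -> smooth_fun A k ->
  smooth_fun A (fun p => h p - k p).
Proof.
move=> sh sk c Ac; have oI := chart_img_open (atlas_chart hA Ac).
exact: (smoothB oI (sh _ Ac) (sk _ Ac)).
Qed.

Lemma smooth_funZ a (h : M -> R) : smooth_fun A h ->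
  smooth_fun A (fun p => a * h p).
Proof.
move=> sh c Ac; have oI := chart_img_open (atlas_chart hA Ac).
exact: (smoothM oI (smooth_cst _ a) (sh _ Ac)).
Qed.

Lemma smooth_fun_cst (a : R) : smooth_fun A (cst a).
Proof. by move=> c Ac; exact: smooth_cst. Qed.

End SmoothFun.

(** * Lie brackets in a chart *)

Section Bracket.
Variables (R : realType) (M : topologicalType) (n : nat).
Variable A : set (chart R M n).
Hypothesis hA : smooth_manifold A.
Implicit Types (c : chart R M n) (X Y Z : M -> tvector R M).

Lemma vact_nonsmooth X h : vector_field A X -> ~ smooth_fun A h ->
  vact X h = cst 0.
Proof.
move=> [tX _] nh; apply/funext => p; rewrite /vact.
by have [c [u [_ _ ->]]] := tX p; rewrite coord_tvector_nonsmooth.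
Qed.

(** In [X (Y h) - Y (X h)] the second derivatives of [h] cancel by [derive_comm]; the derivatives of
    the components remain. *)
Lemma lie_bracket_local_rep c X Y x y : A c ->
  vector_field A X -> vector_field A Y ->
  local_rep A c X x -> local_rep A c Y y ->
  local_rep A c (lie_bracket X Y) (fun z => 'D_(x z) y z - 'D_(y z) x z).
Proof.
move=> Ac vX vY Xx Yy z Iz; apply/funext => h; rewrite /lie_bracket.
have hc := atlas_chart hA Ac; have oI := chart_img_open hc.
have [sh|nh] := pselect (smooth_fun A h); last first.
  (* For non-smooth [h] the bracket is [X 0 - Y 0], which is 0 like the default value of
     [coord_tvector]. *)
  rewrite (vact_nonsmooth vX nh) (vact_nonsmooth vY nh).
  rewrite coord_tvector_nonsmooth//.
  have sc : smooth_fun A (cst (0 : R)) by exact: smooth_fun_cst.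
  rewrite -[X in X - _]/(vact X (cst 0) (chart_inv c z)).
  rewrite -[X in _ - X]/(vact Y (cst 0) (chart_inv c z)).
  rewrite (local_rep_vact hA Ac Xx sc Iz) (local_rep_vact hA Ac Yy sc Iz).
  by rewrite -[cst 0 \o _]/(cst 0) !derive_cst subrr.
have sf := sh _ Ac; set f := h \o chart_inv c in sf.
have sx := local_rep_smooth hA Ac vX Xx.
have sy := local_rep_smooth hA Ac vY Yy.
have E W V w v : vector_field A W -> vector_field A V ->
    local_rep A c W w -> local_rep A c V v -> smooth_on (chart_img c) v ->
    W (chart_inv c z) (vact V h) =
    'D_('D_(w z) v z) f z + 'D_(w z) (fun z' => 'D_(v z) f z') z.
  move=> vW vV Ww Vv sv; rewrite -[LHS]/(vact W (vact V h) (chart_inv c z)).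
  rewrite (local_rep_vact hA Ac Ww (vV.2 _ sh) Iz).
  rewrite -(derive_derive_along oI _ Iz sf sv); apply: near_eq_derive.
  apply: (near_open oI Iz) => z' Iz'.
  exact: (local_rep_vact hA Ac Vv sh Iz').
rewrite (E _ _ _ _ vX vY Xx Yy sy) (E _ _ _ _ vY vX Yy Xx sx).
rewrite (derive_comm (x z) (y z) oI Iz (sf 2%N)).
have df := smooth_differentiable sf Iz.
rewrite (coord_tvectorE _ _ _ sh) (chart_invK hc Iz) -/f.
set k := 'D_(y z) (fun _ => _) z; rewrite [_ + k in X in _ - X]addrC addrKA.
by rewrite (deriveE _ df) (deriveE _ df) (deriveE _ df) linearB.
Qed.

Lemma lie_bracket_vector_field X Y :
  vector_field A X -> vector_field A Y -> vector_field A (lie_bracket X Y).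
Proof.
move=> vX vY; split=> [p|h sh]; last first.
  exact: (smooth_funB hA (vX.2 _ (vY.2 _ sh)) (vY.2 _ (vX.2 _ sh))).
have [c Ac cp] := atlas_cover hA p; have hc := atlas_chart hA Ac.
have [x Xx] := local_rep_exists hA Ac vX.
have [y Yy] := local_rep_exists hA Ac vY.
have L := lie_bracket_local_rep Ac vX vY Xx Yy.
rewrite -(chart_mapK hc cp) L; last exact: chart_img_map.
by apply: tangent_coord => //; rewrite chart_mapK.
Qed.

End Bracket.

(** * The Koszul form in a chart *)

(** The odd [a]'s are the first and the even ones the second of the two terms in which a field is
    differentiated, in [X<Y,Z>], [Y<Z,X>], [Z<X,Y>] in turn. The [b]'s are the even ones with the
    arguments of the metric exchanged, and the [d]'s are derivatives of the metric. Only
    [a2 = G(D_X Y, Z)] survives, counted twice. *)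
Lemma koszul_cancel (K : realFieldType)
    (a1 a3 a5 d1 d2 d3 a2 a4 a6 b2 b4 b6 : K) :
  a2 = b2 -> a4 = b4 -> a6 = b6 ->
  2^-1 * (a1 + a2 + d1 + (a3 + a4 + d2) - (a5 + a6 + d3)
          - (b4 - a5) + (b6 - a1) + (b2 - a3)) = a2 + 2^-1 * (d1 + d2 - d3).
Proof. by move=> <- <- <-; field. Qed.

Section Metric.
Variables (R : realType) (M : topologicalType) (n : nat).
Variable A : set (chart R M n).
Hypothesis hA : smooth_manifold A.
Implicit Types (c : chart R M n) (X Y Z : M -> tvector R M).

Definition local_metric (g : metric R M) c (x u v : 'rV[R]_n) : R :=
  g (chart_inv c x) (coord_tvector A c (chart_inv c x) u)
    (coord_tvector A c (chart_inv c x) v).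

(* The Christoffel symbols of the first kind, contracted with [u], [v], [w]. *)
Definition christoffel (g : metric R M) c (x u v w : 'rV[R]_n) : R :=
  2^-1 * ('D_u (fun y => local_metric g c y v w) x
          + 'D_v (fun y => local_metric g c y w u) x
          - 'D_w (fun y => local_metric g c y u v) x).

Variable g : metric R M.
Hypothesis hg : smooth_metric A g.

Section LocalMetric.
Variables (c : chart R M n) (Ac : A c).
Local Notation G := (local_metric g c).
Let hc : is_chart c := atlas_chart hA Ac.
Let oI : open (chart_img c) := chart_img_open hc.

Lemma local_metric_sym x u v : chart_img c x -> G x u v = G x v u.
Proof.
move=> Ix; have cx := chart_inv_dom hc Ix; have [sg _ _] := hg.
by apply: sg; exact: tangent_coord.
Qed.

Lemma local_metric_linear x : chart_img c x -> forall w a u v,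
  G x w (a *: u + v) = a * G x w u + G x w v.
Proof.
move=> Ix w a u v; have cx := chart_inv_dom hc Ix; have [_ lg _] := hg.
rewrite /local_metric coord_tvector_linear//.
by apply: lg; exact: tangent_coord.
Qed.

Lemma local_metricB x w u v : chart_img c x ->
  G x w (u - v) = G x w u - G x w v.
Proof.
by move=> Ix; rewrite addrC -scaleN1r local_metric_linear// mulN1r addrC.
Qed.

Lemma local_metric_linear_left x : chart_img c x -> forall w a u v,
  G x (a *: u + v) w = a * G x u w + G x v w.
Proof.
move=> Ix w a u v; rewrite !(local_metric_sym _ w)//.
exact: local_metric_linear.
Qed.

(** Smoothness of the metric is given on vector fields only, so [u] and [v] are replaced by global
    fields that have these constant components near the point. *)
Lemma local_metric_smooth u v : smooth_on (chart_img c) (fun x => G x u v).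
Proof.
apply: smooth_local => x Ix; have cx := chart_inv_dom hc Ix.
have [V [oV VI Vx F]] := local_frame hA Ac cx.
rewrite chart_invK// in Vx; exists V => //.
have [X [xX [vX Xx xu]]] := F u; have [Y [yY [vY Yy yv]]] := F v.
have [_ _ sg] := hg.
apply: (smooth_eq oV) (smooth_sub VI (sg _ _ vX vY _ Ac)) => y Vy /=.
have Iy := VI _ Vy.
by rewrite Xx// Yy// xu// yv.
Qed.

(** [derive_linear_family] used in the second slot, then in the first. *)
Lemma derive_local_metric (a b : 'rV[R]_n -> 'rV[R]_n) x w : chart_img c x ->
  smooth_on (chart_img c) a -> smooth_on (chart_img c) b ->
  'D_w (fun y => G y (a y) (b y)) x =
  G x (a x) ('D_w b x) + G x ('D_w a x) (b x)
  + 'D_w (fun y => G y (a x) (b x)) x.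
Proof.
move=> Ix sa sb.
have sGa v : smooth_on (chart_img c) (fun y => G y (a y) v).
  apply: (smooth_linear_family oI (H := fun y u => G y u v)) sa.
    by move=> y Iy ? ? ?; exact: local_metric_linear_left.
  by move=> u; exact: local_metric_smooth.
rewrite (derive_linear_family oI (H := fun y v => G y (a y) v)
  _ sGa w Ix sb); last by move=> y Iy ? ? ?; exact: local_metric_linear.
rewrite -addrA; congr (_ + _).
apply: (derive_linear_family oI (H := fun y u => G y u (b x)) _ _ w Ix sa).
  by move=> y Iy ? ? ?; exact: local_metric_linear_left.
by move=> u; exact: local_metric_smooth.
Qed.

Lemma inner_local_rep X Y x y z : local_rep A c X x -> local_rep A c Y y ->
  chart_img c z -> inner g X Y (chart_inv c z) = G z (x z) (y z).
Proof. by move=> Xx Yy Iz; rewrite /inner Xx// Yy. Qed.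

Lemma koszul_local_rep X Y Z x y z q :
  vector_field A X -> vector_field A Y -> vector_field A Z ->
  local_rep A c X x -> local_rep A c Y y -> local_rep A c Z z ->
  chart_img c q ->
  koszul g X Y Z (chart_inv c q) =
  G q ('D_(x q) y q) (z q) + christoffel g c q (x q) (y q) (z q).
Proof.
move=> vX vY vZ Xx Yy Zz Iq; have [_ _ sg] := hg.
have sx := local_rep_smooth hA Ac vX Xx.
have sy := local_rep_smooth hA Ac vY Yy.
have sz := local_rep_smooth hA Ac vZ Zz.
have act U V W u v w : vector_field A U -> vector_field A V ->
    vector_field A W -> local_rep A c U u -> local_rep A c V v ->
    local_rep A c W w -> smooth_on (chart_img c) v ->
    smooth_on (chart_img c) w ->
    vact U (inner g V W) (chart_inv c q) =
    G q (v q) ('D_(u q) w q) + G q ('D_(u q) v q) (w q)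
    + 'D_(u q) (fun y => G y (v q) (w q)) q.
  move=> vU vV vW Uu Vv Ww sv sw.
  rewrite (local_rep_vact hA Ac Uu (sg _ _ vV vW) Iq).
  rewrite -(derive_local_metric _ Iq sv sw); apply: near_eq_derive.
  by apply: (near_open oI Iq) => t It; exact: inner_local_rep.
have brk U V W u v w : vector_field A U -> vector_field A V ->
    vector_field A W -> local_rep A c U u -> local_rep A c V v ->
    local_rep A c W w ->
    inner g U (lie_bracket V W) (chart_inv c q) =
    G q (u q) ('D_(v q) w q) - G q (u q) ('D_(w q) v q).
  move=> vU vV vW Uu Vv Ww.
  rewrite (inner_local_rep Uu (lie_bracket_local_rep hA Ac vV vW Vv Ww) Iq).
  exact: local_metricB.
rewrite /koszul (act _ _ _ _ _ _ vX vY vZ Xx Yy Zz sy sz).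
rewrite (act _ _ _ _ _ _ vY vZ vX Yy Zz Xx sz sx).
rewrite (act _ _ _ _ _ _ vZ vX vY Zz Xx Yy sx sy).
rewrite (brk _ _ _ _ _ _ vX vY vZ Xx Yy Zz).
rewrite (brk _ _ _ _ _ _ vY vZ vX Yy Zz Xx).
rewrite (brk _ _ _ _ _ _ vZ vX vY Zz Xx Yy).
rewrite /christoffel.
exact: (koszul_cancel _ _ _ _ _ _ (local_metric_sym _ _ Iq)
  (local_metric_sym _ _ Iq) (local_metric_sym _ _ Iq)).
Qed.

End LocalMetric.

Lemma koszul_smooth X Y Z :
  vector_field A X -> vector_field A Y -> vector_field A Z ->
  smooth_fun A (koszul g X Y Z).
Proof.
move=> vX vY vZ; have [_ _ sg] := hg; apply: (smooth_funZ hA).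
have L := lie_bracket_vector_field hA.
do ![apply: (smooth_funB hA)|apply: (smooth_funD hA)].
- exact: (vX.2 _ (sg _ _ vY vZ)).
- exact: (vY.2 _ (sg _ _ vZ vX)).
- exact: (vZ.2 _ (sg _ _ vX vY)).
- exact: (sg _ _ vX (L _ _ vY vZ)).
- exact: (sg _ _ vY (L _ _ vZ vX)).
- exact: (sg _ _ vZ (L _ _ vX vY)).
Qed.

Definition christoffel_bullet := forall c x u v, A c -> chart_img c x ->
  exists y, forall w, christoffel g c x u v w = local_metric g c x y w.

(** On fields with constant components near the point, [D_X Y] vanishes and the Koszul form reduces
    to [christoffel]. *)
Lemma radical_stationary_christoffel : radical_stationary A g ->
  christoffel_bullet.
Proof.
move=> rs c x u v Ac Ix; have hc := atlas_chart hA Ac.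
have cx := chart_inv_dom hc Ix.
have [V [oV VI Vx F]] := local_frame hA Ac cx; rewrite chart_invK// in Vx.
have [X [xX [vX Xx xu]]] := F u; have [Y [yY [vY Yy yv]]] := F v.
have [om [_ om_bullet] omE] := rs _ _ vX vY.
have [t + tE] := om_bullet (chart_inv c x).
move=> /(tangentP hA _ Ac cx)[y ty]; exists y => w.
have [Z [zZ [vZ Zz zw]]] := F w.
have := omE _ vZ (chart_inv c x); rewrite tE; last by have [] := vZ.
rewrite (koszul_local_rep Ac vX vY vZ Xx Yy Zz Ix) ty Zz// xu// yv// zw//.
rewrite -/(local_metric _ _ _ _ _) => ->.
rewrite (_ : 'D_u yY x = 0); last first.
  rewrite -[RHS](derive_cst v x u); apply: near_eq_derive.
  exact: (near_open oV Vx).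
by rewrite -[0]subr0 local_metric_sym// local_metricB// subrr add0r.
Qed.

(** The representing vectors are chosen point by point, with no continuity; smoothness of the
    resulting form comes from [koszul_smooth]. *)
Lemma christoffel_radical_stationary : christoffel_bullet ->
  radical_stationary A g.
Proof.
move=> H X Y vX vY; have [_ lg _] := hg.
suff /choice[y yP] : forall p, exists y, tangent A p y /\
    forall Z, vector_field A Z -> koszul g X Y Z p = g p y (Z p).
  exists (fun p z => g p (y p) z).
    split; last by move=> p; exists (y p) => //; exact: (yP p).1.
    split=> [p|Z vZ]; first exact: lg (yP p).1.
    rewrite (_ : (fun p => _) = koszul g X Y Z); first exact: koszul_smooth.
    by apply/funext => p; rewrite (yP p).2.
  by move=> Z vZ p; rewrite (yP p).2.
move=> p; have [c Ac cp] := atlas_cover hA p; have hc := atlas_chart hA Ac.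
have Ip := chart_img_map cp.
have [x Xx] := local_rep_exists hA Ac vX.
have [y Yy] := local_rep_exists hA Ac vY.
set q := chart_map c p in Ip.
have [t tP] := H c q (x q) (y q) Ac Ip.
(* The vector [D_X Y] represents the first term of [koszul_local_rep], and [t] the Christoffel
   term. *)
exists (coord_tvector A c p ('D_(x q) y q + t)); split.
  exact: tangent_coord.
move=> Z vZ; have [z Zz] := local_rep_exists hA Ac vZ.
have pq : chart_inv c q = p by exact: chart_mapK.
rewrite -pq (koszul_local_rep Ac vX vY vZ Xx Yy Zz Ip) tP Zz//.
rewrite -/(local_metric _ _ _ _ _) -['D_(x q) y q in RHS]scale1r.
by rewrite local_metric_linear_left// mul1r.
Qed.

End Metric.

(** * Products *)

Section ProductTopology.
Variables (S T : topologicalType).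

Lemma hausdorff_prod : hausdorff_space S -> hausdorff_space T ->
  hausdorff_space (S * T)%type.
Proof.
move=> hS hT [p1 p2] [q1 q2] pq.
congr (_, _); [apply: hS|apply: hT] => U V pU qV.
  have [||[x1 x2] [/= Ux Vx]] := pq (fst @^-1` U) (fst @^-1` V).
  - exact: (@cvg_fst _ _ (nbhs p1) (nbhs p2)).
  - exact: (@cvg_fst _ _ (nbhs q1) (nbhs q2)).
  by exists x1.
have [||[x1 x2] [/= Ux Vx]] := pq (snd @^-1` U) (snd @^-1` V).
- exact: (@cvg_snd _ _ (nbhs p1) (nbhs p2)).
- exact: (@cvg_snd _ _ (nbhs q1) (nbhs q2)).
by exists x2.
Qed.

Lemma open_setX (U : set S) (V : set T) : open U -> open V -> open (U `*` V).
Proof.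
move=> oU oV; rewrite openE => -[x y] [/= Ux Vy].
by exists (U, V) => //=; split; exact: open_nbhs_nbhs.
Qed.

Lemma second_countable_prod : @second_countable S -> @second_countable T ->
  @second_countable (S * T)%type.
Proof.
move=> [A cA [oA bA]] [B cB [oB bB]].
exists [set U `*` V | U in A & V in B].
  rewrite image2E; apply: sub_countable (countableX cA cB).
  exact: card_image_le.
split=> [_ [U AU [V BV <-]]|[x y] N].
  by apply: open_setX; [exact: oA|exact: oB].
move=> [[N1 N2] /= [xN1 yN2] NN].
have [U [AU Ux] UN] := bA x _ xN1.
have [V [BV Vy] VN] := bB y _ yN2.
exists (U `*` V); first by split; [exists U => //; exists V|].
by move=> [s t] [/= Us Vt]; apply: NN; split; [exact: UN|exact: VN].
Qed.

End ProductTopology.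

Section Blocks.
Variables (R : realType) (m n : nat).
Implicit Types U : set 'rV[R]_(m + n).

Lemma smooth_lsubmx U : open U ->
  smooth_on U (lsubmx : 'rV[R]_(m + n) -> 'rV[R]_m).
Proof.
move=> oU; apply/(smooth_coordP oU) => j.
rewrite (_ : (fun x => _) = (fun x : 'rV[R]_(m + n) => x 0 (lshift n j))).
  exact: smooth_coord.
by apply/funext => x; rewrite mxE.
Qed.

Lemma smooth_rsubmx U : open U ->
  smooth_on U (rsubmx : 'rV[R]_(m + n) -> 'rV[R]_n).
Proof.
move=> oU; apply/(smooth_coordP oU) => j.
rewrite (_ : (fun x => _) = (fun x : 'rV[R]_(m + n) => x 0 (rshift m j))).
  exact: smooth_coord.
by apply/funext => x; rewrite mxE.
Qed.

Lemma smooth_row_mx k (U : set 'rV[R]_k) (f : 'rV[R]_k -> 'rV[R]_m)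
    (g : 'rV[R]_k -> 'rV[R]_n) : open U ->
  smooth_on U f -> smooth_on U g -> smooth_on U (fun x => row_mx (f x) (g x)).
Proof.
move=> oU sf sg; apply/(smooth_coordP oU) => j.
case: (split_ordP j) => i ->.
  rewrite (_ : (fun x => _) = (fun x => f x 0 i)).
    exact: ((smooth_coordP oU f).1 sf i).
  by apply/funext => x; rewrite row_mxEl.
rewrite (_ : (fun x => _) = (fun x => g x 0 i)).
  exact: ((smooth_coordP oU g).1 sg i).
by apply/funext => x; rewrite row_mxEr.
Qed.

Lemma derive_lsubmx (W : normedModType R) (f : 'rV[R]_m -> W) x v :
  differentiable f (lsubmx x) ->
  'D_v (fun y : 'rV[R]_(m + n) => f (lsubmx y)) x = 'D_(lsubmx v) f (lsubmx x).
Proof.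
move=> df; have dl := @differentiable_lsubmx R 1 m n x.
rewrite (derive_comp v dl df) (deriveE v dl).
by rewrite (@diff_lin _ _ _ lsubmx)//; exact: continuous_lsubmx.
Qed.

Lemma derive_rsubmx (W : normedModType R) (f : 'rV[R]_n -> W) x v :
  differentiable f (rsubmx x) ->
  'D_v (fun y : 'rV[R]_(m + n) => f (rsubmx y)) x = 'D_(rsubmx v) f (rsubmx x).
Proof.
move=> df; have dl := @differentiable_rsubmx R 1 m n x.
rewrite (derive_comp v dl df) (deriveE v dl).
by rewrite (@diff_lin _ _ _ rsubmx)//; exact: continuous_rsubmx.
Qed.

Lemma continuous_row_mx (T : topologicalType) (f : T -> 'rV[R]_m)
    (g : T -> 'rV[R]_n) x : {for x, continuous f} -> {for x, continuous g} ->
  {for x, continuous (fun y => row_mx (f y) (g y))}.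
Proof.
move=> cf cg.
have -> : (fun y => row_mx (f y) (g y)) =
    (fun y => row_mx (f y) 0 + row_mx 0 (g y)).
  by apply/funext => y; rewrite add_row_mx addr0 add0r.
(* The two block embeddings are smooth, and order 0 of smoothness is continuity. *)
have sid k : smooth_on setT (id : 'rV[R]_k -> 'rV[R]_k).
  by apply/(smooth_coordP openT) => j; exact: smooth_coord.
have cl : continuous (fun a : 'rV[R]_m => row_mx a (0 : 'rV[R]_n)).
  move=> a; apply: (smooth_row_mx openT (@sid m) _ 0%N) => //.
  exact: smooth_cst.
have cr : continuous (fun b : 'rV[R]_n => row_mx (0 : 'rV[R]_m) b).
  move=> b; apply: (smooth_row_mx openT _ (@sid n) 0%N) => //.
  exact: smooth_cst.
apply: (@continuousD _ _ _ (fun y => row_mx (f y) 0) (fun y => row_mx 0 (g y))).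
  exact: (continuous_comp cf (@cl _)).
exact: (continuous_comp cg (@cr _)).
Qed.

End Blocks.

(** * The product atlas and the two projections *)

Section ProductCharts.
Variables (R : realType) (B F : topologicalType) (m n : nat).
Variables (AB : set (chart R B m)) (AF : set (chart R F n)).
Hypotheses (hB : smooth_manifold AB) (hF : smooth_manifold AF).
Local Notation A := (prod_atlas AB AF).

Lemma prod_chart_img (c : chart R B m) (d : chart R F n) :
  chart_img (prod_chart c d) =
  [set x | chart_img c (lsubmx x) /\ chart_img d (rsubmx x)].
Proof.
apply/seteqP; split=> [_ [p [/= cp dp] <-]|x [[p cp px] [q dq qx]]].
  by rewrite /= row_mxKl row_mxKr; split; exact: chart_img_map.
by exists (p, q) => //=; rewrite px qx hsubmxK.
Qed.

Lemma prod_is_chart (c : chart R B m) (d : chart R F n) :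
  is_chart c -> is_chart d -> is_chart (prod_chart c d).
Proof.
move=> hc hd; have [oc oIc cc cIc cK] := hc; have [od oId cd cId dK] := hd.
have oP : open (chart_dom (prod_chart c d)) by exact: open_setX.
have oIP : open (chart_img (prod_chart c d)).
  rewrite prod_chart_img; apply: openI.
    by apply: open_comp => // x _; exact: continuous_lsubmx.
  by apply: open_comp => // x _; exact: continuous_rsubmx.
rewrite continuous_open_subspace// in cc.
rewrite continuous_open_subspace// in cd.
rewrite continuous_open_subspace// in cIc.
rewrite continuous_open_subspace// in cId.
split => //.
- rewrite continuous_open_subspace// => p; rewrite inE => -[cp dp].
  apply: (@continuous_row_mx _ _ _ _ (chart_map c \o fst) (chart_map d \o snd)).
    by apply: continuous_comp; [exact: cvg_fst|apply: cc; exact/mem_set].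
  by apply: continuous_comp; [exact: cvg_snd|apply: cd; exact/mem_set].
- rewrite continuous_open_subspace// => x.
  rewrite inE prod_chart_img => -[cx dx].
  apply: (@cvg_pair _ _ _ (nbhs x) (nbhs (chart_inv c (lsubmx x)))
    (nbhs (chart_inv d (rsubmx x))) _ _ _ (chart_inv c \o lsubmx)
    (chart_inv d \o rsubmx)).
    apply: continuous_comp; first exact: continuous_lsubmx.
    by apply: cIc; exact/mem_set.
  apply: continuous_comp; first exact: continuous_rsubmx.
  by apply: cId; exact/mem_set.
- by move=> [p q] [/= cp dq]; rewrite row_mxKl row_mxKr cK ?dK.
Qed.

Lemma prod_smooth_manifold : smooth_manifold A.
Proof.
have [HB SB _ covB trB] := hB; have [HF SF _ covF trF] := hF.
have chartA c : A c -> is_chart c.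
  move=> [c1 Ac1 [c2 Ac2 <-]].
  exact: (prod_is_chart (atlas_chart hB Ac1) (atlas_chart hF Ac2)).
split => //; first exact: hausdorff_prod.
- exact: second_countable_prod.
- move=> [p q]; have [c1 Ac1 cp] := covB p; have [c2 Ac2 cq] := covF q.
  by exists (prod_chart c1 c2) => //; exists c1 => //; exists c2.
move=> c d Ac Ad; rewrite /smooth_transition.
rewrite (chart_map_image (chartA _ Ac)).
have : open (chart_img c `&` chart_inv c @^-1` chart_dom d).
  by apply: open_chart_preimage; [exact: chartA|have [] := chartA _ Ad].
move: Ac Ad => [c1 Ac1 [c2 Ac2 <-]] [d1 Ad1 [d2 Ad2 <-]].
rewrite prod_chart_img.
set O := (O in open O -> _) => oO.
(* The transition map of product charts is the row of the transition maps of the factors, each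
   applied to its own block of coordinates. *)
have O1 x : O x -> overlap d1 c1 (lsubmx x) by move=> [[Ix Jx] [/= dx dx']].
have O2 x : O x -> overlap d2 c2 (rsubmx x) by move=> [[Ix Jx] [/= dx dx']].
have s1 := transition_smooth hB Ad1 Ac1.
have s2 := transition_smooth hF Ad2 Ac2.
have o1 := overlap_open hB Ad1 Ac1; have o2 := overlap_open hF Ad2 Ac2.
apply: smooth_row_mx => //.
  apply/(smooth_coordP oO) => j.
  exact: (smooth_comp oO o1 O1 ((smooth_coordP o1 _).1 s1 j)
    (smooth_lsubmx oO)).
apply/(smooth_coordP oO) => j.
exact: (smooth_comp oO o2 O2 ((smooth_coordP o2 _).1 s2 j) (smooth_rsubmx oO)).
Qed.

Lemma smooth_fun_fst h : smooth_fun AB h -> smooth_fun A (h \o fst).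
Proof.
move=> sh _ [c Ac [d Ad <-]].
have hcd := prod_is_chart (atlas_chart hB Ac) (atlas_chart hF Ad).
have oI := chart_img_open hcd.
have oIc := chart_img_open (atlas_chart hB Ac).
have Il x : chart_img (prod_chart c d) x -> chart_img c (lsubmx x).
  by rewrite prod_chart_img => -[].
exact: (smooth_comp oI oIc Il (sh _ Ac) (smooth_lsubmx oI)).
Qed.

Lemma smooth_fun_snd h : smooth_fun AF h -> smooth_fun A (h \o snd).
Proof.
move=> sh _ [c Ac [d Ad <-]].
have hcd := prod_is_chart (atlas_chart hB Ac) (atlas_chart hF Ad).
have oI := chart_img_open hcd.
have oId := chart_img_open (atlas_chart hF Ad).
have Ir x : chart_img (prod_chart c d) x -> chart_img d (rsubmx x).
  by rewrite prod_chart_img => -[].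
exact: (smooth_comp oI oId Ir (sh _ Ad) (smooth_rsubmx oI)).
Qed.

(** In product charts the projection is [lsubmx]. The smoothness test built into [differential]
    makes both sides 0 at a non-smooth [h]. *)
Lemma differential_fst c d p w : AB c -> AF d -> chart_dom c p.1 ->
  differential AB fst (coord_tvector A (prod_chart c d) p w) =
  coord_tvector AB c p.1 (lsubmx w).
Proof.
move=> Ac Ad cp; apply/funext => h; rewrite /differential.
case: asboolP => [sh|nh]; last by rewrite coord_tvector_nonsmooth.
rewrite (coord_tvectorE _ _ _ sh) (coord_tvectorE _ _ _ (smooth_fun_fst sh)).
set x := chart_map (prod_chart c d) p.
have xl : lsubmx x = chart_map c p.1 by rewrite row_mxKl.
rewrite -xl -derive_lsubmx// xl; apply: (smooth_fun_differentiable Ac sh).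
exact: chart_img_map.
Qed.

Lemma differential_snd c d p w : AB c -> AF d -> chart_dom d p.2 ->
  differential AF snd (coord_tvector A (prod_chart c d) p w) =
  coord_tvector AF d p.2 (rsubmx w).
Proof.
move=> Ac Ad cp; apply/funext => h; rewrite /differential.
case: asboolP => [sh|nh]; last by rewrite coord_tvector_nonsmooth.
rewrite (coord_tvectorE _ _ _ sh) (coord_tvectorE _ _ _ (smooth_fun_snd sh)).
set x := chart_map (prod_chart c d) p.
have xr : rsubmx x = chart_map d p.2 by rewrite row_mxKr.
rewrite -xr -derive_rsubmx// xr; apply: (smooth_fun_differentiable Ad sh).
exact: chart_img_map.
Qed.

Lemma tangent_fst p v : tangent A p v -> tangent AB p.1 (differential AB fst v).
Proof.
move=> [_ [w [[c Ac [d Ad <-]] [cp dp] ->]]].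
by rewrite differential_fst//; exact: tangent_coord.
Qed.

Lemma tangent_snd p v : tangent A p v -> tangent AF p.2 (differential AF snd v).
Proof.
move=> [_ [w [[c Ac [d Ad <-]] [cp dp] ->]]].
by rewrite differential_snd//; exact: tangent_coord.
Qed.

End ProductCharts.

Lemma differential_linear (R : realType) (M N : topologicalType) k
    (A : set (chart R N k)) (phi : M -> N) a (u v : tvector R M) :
  differential A phi (a *: u + v) =
  a *: differential A phi u + differential A phi v.
Proof.
apply/funext => h; rewrite /differential !fctE.
by case: asboolP => // _; rewrite scaler0 addr0.
Qed.

(** * The warped metric *)

(** Here [p] is the value of [f]; the [a]'s, [b]'s, [e]'s and [d]'s are derivatives of the warped
    metric, of [gB], of [gF] and of [f]; the [k]'s are values of [gF], and [k2 = l2] is its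
    symmetry. *)
Lemma warped_christoffel_algebra (K : realFieldType)
    (p a1 a2 a3 b1 b2 b3 e1 e2 e3 d1 d2 d3 k1 k2 l2 k3 : K) :
  a1 = b1 + p ^+ 2 * e1 + 2 * p * d1 * k1 ->
  a2 = b2 + p ^+ 2 * e2 + 2 * p * d2 * k2 ->
  a3 = b3 + p ^+ 2 * e3 + 2 * p * d3 * k3 -> k2 = l2 ->
  2^-1 * (a1 + a2 - a3) =
  2^-1 * (b1 + b2 - b3) + p ^+ 2 * (2^-1 * (e1 + e2 - e3))
  + p * (d1 * k1 + d2 * l2 - d3 * k3).
Proof. by move=> -> -> -> ->; field. Qed.

(** The assumption on [q] is what remains of [q = p^-1] when [p] may be 0. It suffices because [q]
    occurs only multiplied by [p^2]. *)
Lemma warped_bullet_algebra (K : comNzRingType)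
    (p q d1 d2 k0 k1 k2 k3 b a : K) : p ^+ 2 * q = p ->
  a + p ^+ 2 * k3 + p * (d1 * k1 + d2 * k2 - b * k0) =
  - (p * k0) * b + a + p ^+ 2 * (q * d1 * k1 + (q * d2 * k2 + k3)).
Proof.
move=> E; have -> : p ^+ 2 * (q * d1 * k1 + (q * d2 * k2 + k3)) =
    p ^+ 2 * q * (d1 * k1 + d2 * k2) + p ^+ 2 * k3 by ring.
by rewrite E; ring.
Qed.

Section Warped.
Variables (R : realType) (B F : topologicalType) (m n : nat).
Variables (AB : set (chart R B m)) (AF : set (chart R F n)).
Variables (gB : metric R B) (gF : metric R F) (f : B -> R).
Hypotheses (hB : smooth_manifold AB) (hF : smooth_manifold AF).
Hypotheses (hgB : smooth_metric AB gB) (hgF : smooth_metric AF gF).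
Hypothesis hf : smooth_fun AB f.
Local Notation A := (prod_atlas AB AF).
Local Notation g := (warped_metric AB AF gB gF f).
Let hA : smooth_manifold A := prod_smooth_manifold hB hF.

Section Local.
Variables (c : chart R B m) (d : chart R F n).
Hypotheses (Ac : AB c) (Ad : AF d).
Local Notation phi := (f \o chart_inv c).
Local Notation GB := (local_metric AB gB c).
Local Notation GF := (local_metric AF gF d).
Let oIc : open (chart_img c) := chart_img_open (atlas_chart hB Ac).
Let oId : open (chart_img d) := chart_img_open (atlas_chart hF Ad).
Let Acd : A (prod_chart c d).
Proof. by exists c => //; exists d. Qed.
Let oI : open (chart_img (prod_chart c d)) :=
  chart_img_open (atlas_chart hA Acd).

Lemma prod_img_l x : chart_img (prod_chart c d) x -> chart_img c (lsubmx x).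
Proof. by rewrite prod_chart_img => -[]. Qed.

Lemma prod_img_r x : chart_img (prod_chart c d) x -> chart_img d (rsubmx x).
Proof. by rewrite prod_chart_img => -[]. Qed.

Lemma warped_local_metric x u v : chart_img (prod_chart c d) x ->
  local_metric A g (prod_chart c d) x u v =
  GB (lsubmx x) (lsubmx u) (lsubmx v)
  + phi (lsubmx x) ^+ 2 * GF (rsubmx x) (rsubmx u) (rsubmx v).
Proof.
move=> Ix; have cx := chart_inv_dom (atlas_chart hB Ac) (prod_img_l Ix).
have dx := chart_inv_dom (atlas_chart hF Ad) (prod_img_r Ix).
rewrite /local_metric /warped_metric /pullback_metric.
by rewrite !(differential_fst hB hF)// !(differential_snd hB hF).
Qed.

Lemma warped_local_metric_smooth u v :
  smooth_on (chart_img (prod_chart c d))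
    (fun x => local_metric A g (prod_chart c d) x u v).
Proof.
have sB := smooth_comp oI oIc (@prod_img_l)
  (local_metric_smooth hB hgB Ac (lsubmx u) (lsubmx v)) (smooth_lsubmx oI).
have sF := smooth_comp oI oId (@prod_img_r)
  (local_metric_smooth hF hgF Ad (rsubmx u) (rsubmx v)) (smooth_rsubmx oI).
have sf := smooth_comp oI oIc (@prod_img_l) (hf Ac) (smooth_lsubmx oI).
apply: (smooth_eq oI) (smoothD oI sB (smoothM oI (smoothM oI sf sf) sF)).
by move=> x Ix; rewrite warped_local_metric.
Qed.

Lemma derive_warped_local_metric x u v w : chart_img (prod_chart c d) x ->
  'D_w (fun y => local_metric A g (prod_chart c d) y u v) x =
  'D_(lsubmx w) (fun y => GB y (lsubmx u) (lsubmx v)) (lsubmx x)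
  + phi (lsubmx x) ^+ 2
    * 'D_(rsubmx w) (fun y => GF y (rsubmx u) (rsubmx v)) (rsubmx x)
  + 2 * phi (lsubmx x) * 'D_(lsubmx w) phi (lsubmx x)
    * GF (rsubmx x) (rsubmx u) (rsubmx v).
Proof.
move=> Ix; have Il := prod_img_l Ix; have Ir := prod_img_r Ix.
have dB := smooth_differentiable
  (local_metric_smooth hB hgB Ac (lsubmx u) (lsubmx v)) Il.
have dF := smooth_differentiable
  (local_metric_smooth hF hgF Ad (rsubmx u) (rsubmx v)) Ir.
have dphi := smooth_differentiable (hf Ac) Il.
rewrite -(derive_lsubmx w dB) -(derive_rsubmx w dF) -(derive_lsubmx w dphi).
set b := (fun y => GB (lsubmx y) _ _); set k := (fun y => GF (rsubmx y) _ _).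
set p := (fun y : 'rV[R]_(m + n) => phi (lsubmx y)).
have db : derivable b x w.
  apply: diff_derivable.
  exact: (differentiable_comp (differentiable_lsubmx _) dB).
have dk : derivable k x w.
  apply: diff_derivable.
  exact: (differentiable_comp (differentiable_rsubmx _) dF).
have dp : derivable p x w.
  apply: diff_derivable.
  exact: (differentiable_comp (differentiable_lsubmx _) dphi).
(* The square of [f] is written as a product, so that the product rule applies twice. *)
have N : \near x, local_metric A g (prod_chart c d) x u v = (b + p * p * k) x.
  by apply: (near_open oI Ix) => y Iy; rewrite warped_local_metric.
rewrite (near_eq_derive _ N).
rewrite (deriveD db (derivableM (derivableM dp dp) dk)).
rewrite (deriveM (derivableM dp dp) dk) (deriveM dp dp).
rewrite -/(p x) -/(k x) /GRing.scale /= !fctE.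
set x1 := 'D_w b x; set x2 := 'D_w k x; set x3 := 'D_w p x.
ring.
Qed.

Lemma warped_christoffel x u v w : chart_img (prod_chart c d) x ->
  christoffel A g (prod_chart c d) x u v w =
  christoffel AB gB c (lsubmx x) (lsubmx u) (lsubmx v) (lsubmx w)
  + phi (lsubmx x) ^+ 2
    * christoffel AF gF d (rsubmx x) (rsubmx u) (rsubmx v) (rsubmx w)
  + phi (lsubmx x) *
    ('D_(lsubmx u) phi (lsubmx x) * GF (rsubmx x) (rsubmx v) (rsubmx w)
     + 'D_(lsubmx v) phi (lsubmx x) * GF (rsubmx x) (rsubmx u) (rsubmx w)
     - 'D_(lsubmx w) phi (lsubmx x) * GF (rsubmx x) (rsubmx u) (rsubmx v)).
Proof.
move=> Ix; rewrite /christoffel.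
apply: (warped_christoffel_algebra (derive_warped_local_metric v w u Ix)
  (derive_warped_local_metric w u v Ix) (derive_warped_local_metric u v w Ix)).
exact: (local_metric_sym hF hgF Ad _ _ (prod_img_r Ix)).
Qed.

Lemma warped_local_metric_linear x : chart_img (prod_chart c d) x ->
  forall w a u v, local_metric A g (prod_chart c d) x w (a *: u + v) =
  a * local_metric A g (prod_chart c d) x w u
  + local_metric A g (prod_chart c d) x w v.
Proof.
move=> Ix w a u v; rewrite !warped_local_metric// !linearP.
rewrite (local_metric_linear hB hgB Ac (prod_img_l Ix)).
rewrite (local_metric_linear hF hgF Ad (prod_img_r Ix)); ring.
Qed.

Lemma warped_local_metric_linear_left x : chart_img (prod_chart c d) x ->
  forall w a u v, local_metric A g (prod_chart c d) x (a *: u + v) w =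
  a * local_metric A g (prod_chart c d) x u w
  + local_metric A g (prod_chart c d) x v w.
Proof.
move=> Ix w a u v; rewrite !warped_local_metric// !linearP.
rewrite (local_metric_linear_left hB hgB Ac (prod_img_l Ix)).
rewrite (local_metric_linear_left hF hgF Ad (prod_img_r Ix)); ring.
Qed.

End Local.

Lemma warped_smooth_metric : smooth_metric A g.
Proof.
have [symB linB _] := hgB; have [symF linF _] := hgF.
have tB := tangent_fst hB hF; have tF := tangent_snd hB hF.
split.
- move=> p u v tu tv; rewrite /warped_metric /pullback_metric.
  by rewrite (symB _ _ _ (tB _ _ tu) (tB _ _ tv))
    (symF _ _ _ (tF _ _ tu) (tF _ _ tv)).
- move=> p w tw a u v tu tv; rewrite /warped_metric /pullback_metric.
  rewrite !differential_linear.
  rewrite (linB _ _ (tB _ _ tw) _ _ _ (tB _ _ tu) (tB _ _ tv)).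
  rewrite (linF _ _ (tF _ _ tw) _ _ _ (tF _ _ tu) (tF _ _ tv)).
  by ring.
move=> X Y vX vY e Ae; have oI := chart_img_open (atlas_chart hA Ae).
have [x Xx] := local_rep_exists hA Ae vX.
have [y Yy] := local_rep_exists hA Ae vY.
have sx := local_rep_smooth hA Ae vX Xx.
have sy := local_rep_smooth hA Ae vY Yy.
(* In the chart, the inner product of two fields is the local metric at moving vectors;
   [smooth_linear_family] in each slot reduces it to constant vectors. *)
apply: (smooth_eq oI) (_ : smooth_on _
  (fun z => local_metric A g e z (x z) (y z))).
  by move=> z Iz; rewrite /= (Xx _ Iz) (Yy _ Iz).
move: Ae oI Xx Yy sx sy => [c Ac [d Ad <-]] oI _ _ sx sy.
apply: (smooth_linear_family oI
  (H := fun z v => local_metric A g (prod_chart c d) z (x z) v)) sy.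
  by move=> z Iz w a u; exact: warped_local_metric_linear.
move=> v; apply: (smooth_linear_family oI
  (H := fun z u => local_metric A g (prod_chart c d) z u v)) sx.
  by move=> z Iz ? ? ?; exact: warped_local_metric_linear_left.
by move=> u; exact: warped_local_metric_smooth.
Qed.

Lemma warped_christoffel_bullet :
  christoffel_bullet AB gB -> christoffel_bullet AF gF ->
  (forall p, bullet AB gB p (dform f p)) -> christoffel_bullet A g.
Proof.
move=> HB HF Hf _ x u v [c Ac [d Ad <-]] Ix.
have Il := prod_img_l Ix; have Ir := prod_img_r Ix.
have [a aE] := HB c _ (lsubmx u) (lsubmx v) Ac Il.
have [k kE] := HF d _ (rsubmx u) (rsubmx v) Ad Ir.
have hc := atlas_chart hB Ac; have cx := chart_inv_dom hc Il.
have [t + tE] := Hf (chart_inv c (lsubmx x)).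
move=> /(tangentP hB _ Ac cx)[b tb].
have bE w : 'D_w (f \o chart_inv c) (lsubmx x) =
    local_metric AB gB c (lsubmx x) b w.
  rewrite /local_metric -tb -tE; last exact: tangent_coord.
  by rewrite /dform coord_tvectorE// chart_invK.
pose p := (f \o chart_inv c) (lsubmx x).
pose k0 := local_metric AF gF d (rsubmx x) (rsubmx u) (rsubmx v).
pose du := 'D_(lsubmx u) (f \o chart_inv c) (lsubmx x).
pose dv := 'D_(lsubmx v) (f \o chart_inv c) (lsubmx x).
exists (row_mx (- (p * k0) *: b + a)
  (p^-1 * du *: rsubmx v + (p^-1 * dv *: rsubmx u + k))) => w.
rewrite (warped_christoffel Ac Ad u v w Ix) (warped_local_metric Ac Ad _ _ Ix).
rewrite row_mxKl row_mxKr (local_metric_linear_left hB hgB Ac Il).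
rewrite !(local_metric_linear_left hF hgF Ad Ir) aE kE.
rewrite -/p -/k0 -/du -/dv (bE (lsubmx w)).
(* At a zero of [f] this holds by the convention [0^-1 = 0]. *)
have pp : p ^+ 2 * p^-1 = p.
  have [->|p0] := eqVneq p 0; first by rewrite expr0n mul0r.
  by rewrite expr2 mulfK.
exact: warped_bullet_algebra.
Qed.

End Warped.

Theorem theorem4p1 (R : realType) (B F : topologicalType) (m n : nat)
    (AB : set (chart R B m)) (AF : set (chart R F n))
    (gB : metric R B) (gF : metric R F) (f : B -> R)
    (hB : singular_semi_riemannian AB gB)
    (hF : singular_semi_riemannian AF gF)
    (hBrs : radical_stationary AB gB)
    (hFrs : radical_stationary AF gF)
    (hf : smooth_fun AB f)
    (hdf : bullet_form AB gB (dform f)) :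
  singular_semi_riemannian (prod_atlas AB AF) (warped_metric AB AF gB gF f) /\
  radical_stationary (prod_atlas AB AF) (warped_metric AB AF gB gF f).
Proof.
have [mB sB] := hB; have [mF sF] := hF; have [_ bf] := hdf.
have mBF := prod_smooth_manifold mB mF.
have sBF := warped_smooth_metric mB mF sB sF hf.
split; first by split.
apply: (christoffel_radical_stationary mBF sBF).
apply: (warped_christoffel_bullet mB mF sB sF hf _ _ bf).
  exact: (radical_stationary_christoffel mB sB hBrs).
exact: (radical_stationary_christoffel mF sF hFrs).
Qed.
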